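(* Let $n$ be a fixed odd number and $m\ge0$. Then for any $0\le k\le m$ and any integer $j\ge0$, $$\mathcal{C}_{m+1}(\bar x^kx^j)=\begin{cases}0 & \text{if } j<n-1,\\ x_0^k\,4^{\frac{n-1}{2}}(-1)^{\frac{n-1}{2}}\left[\Gamma\left(\frac{n+1}{2}\right)\right]^2 & \text{if } j=n-1,\\ \left[\Gamma\left(\frac{n+1}{2}\right)\right]^2 2^{n-1}(-1)^{\frac{n-1}{2}}\frac{(n)_{j+1-n}}{(j+1-n)!}\,x_0^kP_{j+1-n}^n(x) & \text{if } j\ge n-1.\end{cases}$$
   Context: $\mathbb{R}_n$ is the real Clifford algebra generated by $e_1,\dots,e_n$ with $e_\ell e_m+e_me_\ell=0$ for $\ell\ne m$ and $e_\ell^2=-1$. A point $(x_0,\dots,x_n)\in\mathbb{R}^{n+1}$ is identified with the paravector $x=x_0+\underline{x}$, $\underline{x}=\sum_{\ell=1}^n x_\ell e_\ell$; $\bar x=x_0-\underline{x}$. $\Delta_{\mathbb{R}^{n+1}}=\sum_{i=0}^n\partial_{x_i}^2$. $(a)_0=1$ and $(a)_s=a(a+1)\cdots(a+s-1)$ for $s>0$. The Clifford-Appell polynomials are $$P_k^n(x):=\sum_{s=0}^k T_s^k(n)\,x^{k-s}\bar x^{s},\qquad T_s^k(n):=\binom{k}{s}\frac{\left(\frac{n+1}{2}\right)_{k-s}\left(\frac{n-1}{2}\right)_s}{(n)_k}.$$ $\mathbb{S}^{n-1}$ is the set of $I=\sum_{\ell=1}^n x_\ell e_\ell$ with $\sum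 x_\ell^2=1$. A function $f$ on an axially symmetric slice domain $\Omega\subseteq\mathbb{R}^{n+1}$ is slice monogenic if for each $I\in\mathbb{S}^{n-1}$, $(\partial_u+I\partial_v)f(u+Iv)=0$ on $\Omega\cap(\mathbb{R}+I\mathbb{R})$. A $C^{m+1}$ function $f:\Omega\to\mathbb{R}_n$ is slice polyanalytic of order $m+1$, $f\in\mathcal{SP}_{m+1}(\Omega)$, if it is a slice function (i.e. $f(u+Iv)=\alpha(u,v)+I\beta(u,v)$ with $\alpha$ even and $\beta$ odd in $v$) and $(\partial_u+I\partial_v)^{m+1}f(u+Iv)=0$ for all $I\in\mathbb{S}^{n-1}$. Every such $f$ has a unique decomposition $f(x)=\sum_{k=0}^m\bar x^kf_k(x)$ with $f_0,\dots,f_m$ slice monogenic on $\Omega$, and the first polyanalytic Fueter-Sce map is defined by $$\mathcal{C}_{m+1}(f)(x):=\sum_{k=0}^m x_0^k\,\Delta_{\mathbb{R}^{n+1}}^{\frac{n-1}{2}}f_k(x).$$ *)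

(* Defs.v *)
From HB Require Import structures.
From mathcomp Require Import all_boot all_order all_algebra.
From mathcomp Require Import all_classical all_reals all_analysis.

Set Implicit Arguments.
Unset Strict Implicit.
Unset Printing Implicit Defensive.

Import Order.TTheory GRing.Theory Num.Theory.
Import numFieldNormedType.Exports.

Local Open Scope classical_set_scope.
Local Open Scope ring_scope.

(* An element of the Clifford algebra is its row of 2^n coordinates on the    *)
(* blades e_A = e_(a_1) ... e_(a_r), A = {a_1 < ... < a_r}. As a row vector   *)
(* type it carries the usual topology of R^(2^n). The generators are          *)
(* indexed from 0.                                                            *)
Definition clifford (R : realType) (n : nat) : Type :=
  'rV[R]_#|{: {set 'I_n}}|.

HB.instance Definition _ (R : realType) (n : nat) :=
  NormedModule.copy (clifford R n) 'rV[R]_#|{: {set 'I_n}}|.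

Definition symdiff (T : finType) (A B : {set T}) : {set T} :=
  (A :\: B) :|: (B :\: A).

Section CliffordRing.
Variables (R : realType) (n : nat).
Implicit Types (x y z : clifford R n) (A B C : {set 'I_n}).

Definition clifford_coef x A : R := (x : 'rV[R]__) 0 (enum_rank A).

Definition blade A : clifford R n := delta_mx 0 (enum_rank A).

(* e_A e_B = blade_sign A B * e_(A symdiff B): moving each factor b of e_B    *)
(* leftwards to its place in e_A costs one sign for each a > b in A, and one  *)
(* more for e_b^2 = -1 when b is in A.                                        *)
Definition blade_sign A B : R := \prod_(a in A) \prod_(b in B | (b <= a)%N) (-1).

Definition clifford_mul x y : clifford R n :=
  \sum_A \sum_B
    (clifford_coef x A * clifford_coef y B * blade_sign A B)
      *: blade (symdiff A B).

Lemma clifford_coefD x y A :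
  clifford_coef (x + y) A = clifford_coef x A + clifford_coef y A.
Proof. exact: mxE. Qed.

Lemma clifford_coefZ (a : R) x A :
  clifford_coef (a *: x) A = a * clifford_coef x A.
Proof. exact: mxE. Qed.

Lemma clifford_coef_blade A B : clifford_coef (blade A) B = (B == A)%:R.
Proof.
by rewrite /clifford_coef /blade mxE eqxx (inj_eq enum_rank_inj).
Qed.

Lemma clifford_expand x : x = \sum_A clifford_coef x A *: blade A.
Proof.
rewrite [LHS](row_sum_delta (x : 'rV[R]__)) (reindex enum_rank) /=.
  exact: eq_bigr.
exact/onW_bij/enum_rank_bij.
Qed.

Lemma clifford_mulDl : left_distributive clifford_mul +%R.
Proof.
move=> x y z; rewrite /clifford_mul -big_split /=; apply: eq_bigr => A _.
rewrite -big_split /=; apply: eq_bigr => B _.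
by rewrite clifford_coefD !mulrDl scalerDl.
Qed.

Lemma clifford_mulDr : right_distributive clifford_mul +%R.
Proof.
move=> x y z; rewrite /clifford_mul -big_split /=; apply: eq_bigr => A _.
rewrite -big_split /=; apply: eq_bigr => B _.
by rewrite clifford_coefD mulrDr mulrDl scalerDl.
Qed.

Lemma clifford_mulZl (a : R) x y :
  clifford_mul (a *: x) y = a *: clifford_mul x y.
Proof.
rewrite /clifford_mul scaler_sumr; apply: eq_bigr => A _.
rewrite scaler_sumr; apply: eq_bigr => B _.
by rewrite clifford_coefZ scalerA !mulrA.
Qed.

Lemma clifford_mulZr (a : R) x y :
  clifford_mul x (a *: y) = a *: clifford_mul x y.
Proof.
rewrite /clifford_mul scaler_sumr; apply: eq_bigr => A _.
rewrite scaler_sumr; apply: eq_bigr => B _.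
by rewrite clifford_coefZ scalerA !mulrA (mulrC (clifford_coef x A) a).
Qed.

Lemma clifford_mul_suml (I : Type) (r : seq I) (F : I -> clifford R n) y :
  clifford_mul (\sum_(i <- r) F i) y = \sum_(i <- r) clifford_mul (F i) y.
Proof.
elim: r => [|i r IH]; last by rewrite !big_cons clifford_mulDl IH.
by rewrite !big_nil -[X in clifford_mul X _](scale0r 0) clifford_mulZl scale0r.
Qed.

Lemma clifford_mul_sumr (I : Type) (r : seq I) (F : I -> clifford R n) x :
  clifford_mul x (\sum_(i <- r) F i) = \sum_(i <- r) clifford_mul x (F i).
Proof.
elim: r => [|i r IH]; last by rewrite !big_cons clifford_mulDr IH.
by rewrite !big_nil -[X in clifford_mul _ X](scale0r 0) clifford_mulZr scale0r.
Qed.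

Lemma clifford_mul_blade A B :
  clifford_mul (blade A) (blade B) = blade_sign A B *: blade (symdiff A B).
Proof.
rewrite /clifford_mul (bigD1 A) //= [X in _ + X]big1 ?addr0; last first.
  move=> C /negPf CA; rewrite big1 // => D _.
  by rewrite clifford_coef_blade CA !mul0r scale0r.
rewrite (bigD1 B) //= [X in _ + X]big1 ?addr0; last first.
  move=> C /negPf CB.
  by rewrite [clifford_coef _ C]clifford_coef_blade CB mulr0 mul0r scale0r.
by rewrite !clifford_coef_blade !eqxx !mul1r.
Qed.

Lemma symdiffE (T : finType) (A B : {set T}) i :
  (i \in symdiff A B) = (i \in A) (+) (i \in B).
Proof. by rewrite !inE; case: (i \in A); case: (i \in B). Qed.

Lemma symdiffA (T : finType) : associative (@symdiff T).
Proof. by move=> A B C; apply/setP => i; rewrite !symdiffE addbA. Qed.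

Lemma symdiff0s (T : finType) : left_id finset.set0 (@symdiff T).
Proof. by move=> A; apply/setP => i; rewrite symdiffE inE. Qed.

Lemma symdiffs0 (T : finType) : right_id finset.set0 (@symdiff T).
Proof. by move=> A; apply/setP => i; rewrite symdiffE inE addbF. Qed.

Lemma prod_symdiff (F : 'I_n -> R) A B : (forall i, F i * F i = 1) ->
  \prod_(i in symdiff A B) F i = (\prod_(i in A) F i) * (\prod_(i in B) F i).
Proof.
move=> F1; rewrite [LHS]big_mkcond /= [X in _ = X * _]big_mkcond /=.
rewrite [X in _ = _ * X]big_mkcond -big_split /=; apply: eq_bigr => i _.
rewrite symdiffE.
by case: (i \in A); case: (i \in B) => //=; rewrite ?F1 ?mulr1 ?mul1r.
Qed.

Lemma blade_signDl A B C :
  blade_sign (symdiff A B) C = blade_sign A C * blade_sign B C.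
Proof.
apply: prod_symdiff => a.
by rewrite -big_split /= big1 // => i _; rewrite mulrNN mulr1.
Qed.

Lemma blade_signDr A B C :
  blade_sign A (symdiff B C) = blade_sign A B * blade_sign A C.
Proof.
rewrite /blade_sign -big_split /=; apply: eq_bigr => a _.
rewrite !big_mkcondr; apply: prod_symdiff => b.
by case: ifP; rewrite ?mulrNN mulr1.
Qed.

Lemma clifford_mulA : associative clifford_mul.
Proof.
move=> x y z; rewrite (clifford_expand x) [LHS]clifford_mul_suml.
rewrite [X in _ = clifford_mul X _]clifford_mul_suml [RHS]clifford_mul_suml.
apply: eq_bigr => A _; rewrite !clifford_mulZl; congr (_ *: _).
rewrite (clifford_expand y) [X in clifford_mul _ X = _]clifford_mul_suml.
rewrite [LHS]clifford_mul_sumr [X in _ = clifford_mul X _]clifford_mul_sumr.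
rewrite [RHS]clifford_mul_suml.
apply: eq_bigr => B _; rewrite !(clifford_mulZl, clifford_mulZr).
congr (_ *: _).
rewrite (clifford_expand z) [X in clifford_mul _ X = _]clifford_mul_sumr.
rewrite [LHS]clifford_mul_sumr [RHS]clifford_mul_sumr.
apply: eq_bigr => C _; rewrite !clifford_mulZr; congr (_ *: _).
rewrite !clifford_mul_blade clifford_mulZl clifford_mulZr.
rewrite !clifford_mul_blade !scalerA symdiffA; congr (_ *: _).
by rewrite blade_signDl blade_signDr mulrC mulrA.
Qed.

Lemma clifford_mul1l : left_id (blade finset.set0) clifford_mul.
Proof.
move=> x; rewrite {2}(clifford_expand x) {1}(clifford_expand x).
rewrite clifford_mul_sumr; apply: eq_bigr => A _.
rewrite clifford_mulZr clifford_mul_blade symdiff0s /blade_sign.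
by rewrite big_set0 scale1r.
Qed.

Lemma clifford_mul1r : right_id (blade finset.set0) clifford_mul.
Proof.
move=> x; rewrite {2}(clifford_expand x) {1}(clifford_expand x).
rewrite clifford_mul_suml; apply: eq_bigr => A _.
rewrite clifford_mulZl clifford_mul_blade symdiffs0 /blade_sign.
by rewrite big1 ?scale1r // => a _; rewrite big1 // => b; rewrite inE.
Qed.

Lemma clifford_1neq0 : blade finset.set0 != 0.
Proof.
apply/eqP => /(congr1 (clifford_coef ^~ finset.set0)) /eqP.
by rewrite clifford_coef_blade eqxx /clifford_coef mxE oner_eq0.
Qed.

HB.instance Definition _ := GRing.Zmodule_isNzRing.Build (clifford R n)
  clifford_mulA clifford_mul1l clifford_mul1r clifford_mulDl clifford_mulDr
  clifford_1neq0.

HB.instance Definition _ := GRing.Lmodule_isLalgebra.Build R (clifford R n)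
  (fun a x y => esym (clifford_mulZl a x y)).

HB.instance Definition _ := GRing.Lalgebra_isAlgebra.Build R (clifford R n)
  (fun a x y => esym (clifford_mulZr a x y)).

Definition clifford_gen (l : 'I_n) : clifford R n := blade [set l]%SET.

Lemma clifford_gen_sqr l : clifford_gen l * clifford_gen l = -1.
Proof.
rewrite [LHS]clifford_mul_blade /blade_sign big_set1.
rewrite (eq_bigl (pred1 l)) ?big_pred1_eq; last first.
  by move=> i; rewrite !inE; case: eqP => // ->; rewrite leqnn.
rewrite scaleN1r; congr (- blade _).
by apply/setP => i; rewrite symdiffE addbb inE.
Qed.

Lemma clifford_gen_anticomm l k : l != k ->
  clifford_gen l * clifford_gen k + clifford_gen k * clifford_gen l = 0.
Proof.
have sgn (a b : 'I_n) :
    blade_sign [set a]%SET [set b]%SET = if (b <= a)%N then -1 else 1.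
  rewrite /blade_sign big_set1; case: ifP => ba.
    rewrite (eq_bigl (pred1 b)) ?big_pred1_eq // => i.
    by rewrite !inE; case: eqP => // ->.
  by rewrite big1 // => i /andP[]; rewrite inE => /eqP ->; rewrite ba.
move=> lk; rewrite [X in X + _]clifford_mul_blade.
rewrite [X in _ + X]clifford_mul_blade !sgn /symdiff finset.setUC -scalerDl.
have [kl|kl|/val_inj e] := ltngtP k l; last by rewrite e eqxx in lk.
- by rewrite addNr scale0r.
- by rewrite addrN scale0r.
Qed.

End CliffordRing.

Section Paravectors.
Variables (R : realType) (n : nat).

Notation pt := 'rV[R]_n.+1.
Notation cl := (clifford R n).

Definition vector_part (x : pt) : cl :=
  \sum_(l < n) x 0 (lift ord0 l) *: clifford_gen R l.

Definition paravector (x : pt) : cl := (x 0 0)%:A + vector_part x.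

Definition paraconj (x : pt) : cl := (x 0 0)%:A - vector_part x.

Definition partial (i : 'I_n.+1) (f : pt -> cl) : pt -> cl :=
  fun x => 'D_(delta_mx 0 i) f x.

Definition laplacian (f : pt -> cl) : pt -> cl :=
  fun x => \sum_(i < n.+1) partial i (partial i f) x.

(* f is of class C^k on the open set Om. *)
Fixpoint Ck (k : nat) (Om : set pt) (f : pt -> cl) : Prop :=
  (forall x, Om x -> f @ x --> f x) /\
  if k is k'.+1 then
    forall i : 'I_n.+1,
      (forall x, Om x -> derivable f x (delta_mx 0 i)) /\
      Ck k' Om (partial i f)
  else True.

(* The sphere S^(n-1), inside the hyperplane x_0 = 0 of R^(n+1). *)
Definition unit_sphere : set pt :=
  [set I | I 0 0 = 0 /\ \sum_(l < n) I 0 (lift ord0 l) ^+ 2 = 1].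

(* The point u + I v, and the complex plane R + I R. *)
Definition slice_pt (I : pt) (u v : R) : pt := u *: delta_mx 0 0 + v *: I.

Definition slice_plane (I : pt) : set pt :=
  [set x | exists u v, x = slice_pt I u v].

Definition axially_symmetric (Om : set pt) : Prop :=
  forall I J u v, unit_sphere I -> unit_sphere J ->
    Om (slice_pt I u v) -> Om (slice_pt J u v).

(* The sets Om `&` slice_plane I are automatically open in the slice planes. *)
Definition slice_domain (Om : set pt) : Prop :=
  [/\ open Om, connected Om,
      exists u : R, Om (u *: delta_mx 0 0) &
      forall I, unit_sphere I -> connected (Om `&` slice_plane I)].

Definition restr_slice (f : pt -> cl) (I : pt) : R -> R -> cl :=
  fun u v => f (slice_pt I u v).

(* (d/du + I d/dv) g *)
Definition dbar (I : pt) (g : R -> R -> cl) : R -> R -> cl :=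
  fun u v => derive1 (g ^~ v) u + paravector I * derive1 (g u) v.

Definition slice_monogenic (Om : set pt) (f : pt -> cl) : Prop :=
  (forall x, Om x -> differentiable f x) /\
  (forall I u v, unit_sphere I -> Om (slice_pt I u v) ->
     dbar I (restr_slice f I) u v = 0).

Definition slice_function (Om : set pt) (f : pt -> cl) : Prop :=
  exists alpha beta : R -> R -> cl,
    [/\ forall u v, alpha u (- v) = alpha u v,
        forall u v, beta u (- v) = - beta u v &
        forall I u v, unit_sphere I -> Om (slice_pt I u v) ->
          f (slice_pt I u v) = alpha u v + paravector I * beta u v].

(* SP_N(Om): slice polyanalytic functions of order N. *)
Definition slice_polyanalytic (N : nat) (Om : set pt) (f : pt -> cl) : Prop :=
  [/\ Ck N Om f, slice_function Om f &
      forall I u v, unit_sphere I -> Om (slice_pt I u v) ->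
        iter N (dbar I) (restr_slice f I) u v = 0].

Definition polyanalytic_decomposition (m : nat) (Om : set pt) (f : pt -> cl)
    (g : 'I_m.+1 -> pt -> cl) : Prop :=
  (forall k, slice_monogenic Om (g k)) /\
  (forall x, Om x -> f x = \sum_(k < m.+1) paraconj x ^+ k * g k x).

(* The components f_0, ..., f_m, unique on Om when f is in SP_(m+1)(Om). *)
Definition polyanalytic_components (m : nat) (Om : set pt) (f : pt -> cl) :
    'I_m.+1 -> pt -> cl :=
  xget (fun _ _ => 0) [set g | polyanalytic_decomposition Om f g].

(* The map C_(m+1) on SP_(m+1)(Om), for odd n. *)
Definition polyanalytic_fueter_sce (m : nat) (Om : set pt) (f : pt -> cl) :
    pt -> cl :=
  fun x => \sum_(k < m.+1)
    x 0 0 ^+ k *: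
      iter (n.-1)./2 laplacian (polyanalytic_components Om f k) x.

End Paravectors.

Definition pochhammer (R : realType) (a : R) (s : nat) : R :=
  \prod_(i < s) (a + i%:R).

Definition appell_coef (R : realType) (n k s : nat) : R :=
  'C(k, s)%:R * pochhammer ((n%:R + 1) / 2) (k - s)
    * pochhammer ((n%:R - 1) / 2) s / pochhammer n%:R k.

Definition clifford_appell (R : realType) (n k : nat) (x : 'rV[R]_n.+1) :
    clifford R n :=
  \sum_(s < k.+1)
    appell_coef R n k s *: (paravector x ^+ (k - s) * paraconj x ^+ s).

(* Euler's integral; meaningful for s > 0. *)
Definition Gamma (R : realType) (s : R) : R :=
  \int[lebesgue_measure]_(t in `]0, +oo[) (t `^ (s - 1) * expR (- t)).

(* Main.v *)
(* Write xbar for the conjugate of x and D = (1 - x t) (1 - xbar t)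
   = 1 - 2 x_0 t + |x|^2 t^2. With q_r = (1 - xbar t) D^(-r-1), the generating
   series of the powers of x is q_0, and, because |grad D|^2 = 4 t^2 D,
     Lap q_r = 2 (r + 1) (2 r + 1 - n) t^2 q_(r+1).
   Since q_r = (1 - x t)^(-r-1) (1 - xbar t)^(-r), for r = (n - 1)/2 the
   coefficients of q_r are multiples of the Clifford-Appell polynomials.
   On a slice, d/du + I d/dv lowers the degree in xbar by one and kills slice
   monogenic factors, so polyanalytic components are unique and those of
   xbar^k x^j are x^j in degree k and 0 elsewhere. *)

Require Import Defs.
From HB Require Import structures.
From mathcomp Require Import all_boot all_order all_algebra.
From mathcomp Require Import all_classical all_reals all_analysis.
From mathcomp Require Import measurable_realfun.
From mathcomp Require Import ring zify.

Set Implicit Arguments.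
Unset Strict Implicit.
Unset Printing Implicit Defensive.

Import Order.TTheory GRing.Theory Num.Theory.
Import numFieldNormedType.Exports.

Local Open Scope classical_set_scope.
Local Open Scope ring_scope.

(** * Calculus of Clifford-valued functions *)

Section CliffordCalculus.
Variables (R : realType) (n : nat).
Notation cl := (clifford R n).

(** Series in t appear only through their coefficients: the relation D D^(-l-1) = D^(-l), read in
    degree d, is a recurrence, and every derivative is obtained from it by induction. In q_r = (1 -
    xbar t) D^(-l), l = r + 1, the factor D^(-l) alone would give 2 l (2 l + 1 - n). Since xbar is
    linear, the other factor only adds the cross term -2 t sum_i conj(e_i) d_i D^(-l), with e_0 = 1,
    which equals -4 l t^2 q_(r+1) and brings 2 l + 1 - n down to 2 r + 1 - n. For n = 2 N + 1 the N
    successive factors multiply to (-4)^N N!^2, with N! = Gamma((n + 1)/2), while the factors t^2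
    lower the degree by 2 N = n - 1, whence the vanishing for j < n - 1. The map is defined from an
    arbitrarily chosen decomposition that is specified only on the domain: uniqueness is what makes
    it computable, and openness lets an equality on the domain pass through derivatives. *)

Lemma clifford_mul_is_bilinear :
  bilinear_for
    (GRing.Scale.Law.clone _ _ *:%R _) (GRing.Scale.Law.clone _ _ *:%R _)
    (@clifford_mul R n).
Proof.
split=> [u'|u] a x y /=.
- by rewrite clifford_mulDl clifford_mulZl.
- by rewrite clifford_mulDr clifford_mulZr.
Qed.

HB.instance Definition _ := bilinear_isBilinear.Build R cl cl cl _ _
  (@clifford_mul R n) clifford_mul_is_bilinear.

Lemma clifford_coef_continuous A : continuous (fun x : cl => clifford_coef x A).
Proof. move=> x; exact: coord_continuous. Qed.

Lemma clifford_mul_continuous : continuous (fun p : cl * cl => p.1 * p.2).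
Proof.
move=> p.
apply: cvg_big => [|A _]; first exact: add_continuous.
apply: cvg_big => [|B _]; first exact: add_continuous.
apply: cvgZr_tmp.
apply: cvgMr_tmp.
apply: cvgM.
- exact: (@cvg_comp _ _ _ fst (fun y : cl => clifford_coef y A) _ _ _
    cvg_fst (@clifford_coef_continuous A p.1)).
- exact: (@cvg_comp _ _ _ snd (fun y : cl => clifford_coef y B) _ _ _
    cvg_snd (@clifford_coef_continuous B p.2)).
Qed.

(** A directional derivative gives continuity only along its own line, which is all that the product
    rules below need. *)
Lemma is_derive_line_continuous (V W : normedModType R) (f : V -> W) x v :
  derivable f x v -> f (h *: v + x) @[h --> 0^'] --> f x.
Proof.
move=> df.
suff : {for 0, continuous (fun h : R => f(h *: v + x))}.
  by move=> /continuous_withinNx; rewrite scale0r add0r.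
exact/differentiable_continuous/derivable1_diffP/(derivable1P _ _ _).1.
Qed.

Lemma is_derive_scale (V W : normedModType R) (a : V -> R) (f : V -> W) x v da df :
  is_derive x v a da -> is_derive x v f df ->
  is_derive x v (fun y => a y *: f y) (da *: f x + a x *: df).
Proof.
move=> [da1 da2] [df1 df2].
have lim : h^-1 *: (a (h *: v + x) *: f (h *: v + x) - a x *: f x) @[h --> 0^']
    --> da *: f x + a x *: df.
  have -> : (fun h => h^-1 *: (a (h *: v + x) *: f (h *: v + x) - a x *: f x)) =
    (fun h => (h^-1 *: (a (h *: v + x) - a x)) *: f x +
              a (h *: v + x) *: (h^-1 *: (f (h *: v + x) - f x))).
    apply/funext => h; rewrite -[h^-1 *: (a _ - _)]/(_ * _) -scalerA.
    rewrite (scalerA (a _)) [a _ * _]mulrC -scalerA -scalerDr.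
    by congr (_ *: _); rewrite scalerBl scalerBr [RHS]addrC addrA subrK.
  apply: cvgD.
    by apply: cvgZr_tmp; rewrite -da2; exact: da1.
  apply: cvgZ; first exact: is_derive_line_continuous.
  by rewrite -df2; exact: df1.
split; first by apply/cvg_ex; exists (da *: f x + a x *: df).
exact: cvg_lim lim.
Qed.

(** The difference quotient is constant for h != 0. Coordinates, [paravector] and [paraconj] are all
    differentiated this way. *)
Lemma is_derive_affine (V W : normedModType R) (f : V -> W) x v d :
  (forall h, f (h *: v + x) = h *: d + f x) -> is_derive x v f d.
Proof.
move=> fl.
have lim : h^-1 *: (f (h *: v + x) - f x) @[h --> 0^'] --> d.
  apply: cvg_near_cst; near=> h.
  rewrite fl addrK scalerA mulVf ?scale1r//.
  by near: h; exact: nbhs_dnbhs_neq.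
by split; [apply/cvg_ex; exists d|exact: cvg_lim lim].
Unshelve. all: by end_near. Qed.

Lemma is_derive_clifford_mul (V : normedModType R) (f g : V -> cl) x v df dg :
  is_derive x v f df -> is_derive x v g dg ->
  is_derive x v (fun y => f y * g y) (df * g x + f x * dg).
Proof.
move=> [df1 df2] [dg1 dg2].
have lim : h^-1 *: (f (h *: v + x) * g (h *: v + x) - f x * g x) @[h --> 0^']
    --> df * g x + f x * dg.
  have -> : (fun h => h^-1 *: (f (h *: v + x) * g (h *: v + x) - f x * g x)) =
    (fun h => (h^-1 *: (f (h *: v + x) - f x)) * g x +
              f (h *: v + x) * (h^-1 *: (g (h *: v + x) - g x))).
    apply/funext => h; rewrite -scalerAl -scalerAr -scalerDr mulrBl mulrBr.
    by congr (_ *: _); rewrite [RHS]addrC addrA subrK.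
  apply: cvgD.
    apply: (cvg_comp2 _ _ (@clifford_mul_continuous (df, g x))) => /=.
      by rewrite -df2; exact: df1.
    exact: cvg_cst.
  apply: (cvg_comp2 _ _ (@clifford_mul_continuous (f x, dg))) => /=.
    exact: is_derive_line_continuous.
  by rewrite -dg2; exact: dg1.
split; first by apply/cvg_ex; exists (df * g x + f x * dg).
exact: cvg_lim lim.
Qed.

(** In a noncommutative algebra Leibniz gives a sum of terms f^a df f^b; commutation gathers them.
    On a slice it holds because all values lie in R + I R. *)
Lemma is_derive_clifford_exp (V : normedModType R) (f : V -> cl) x v df k :
  GRing.comm (f x) df -> is_derive x v f df ->
  is_derive x v (fun y => f y ^+ k) ((k%:R : R) *: (f x ^+ k.-1 * df)).
Proof.
move=> cf fd; elim: k => [|k IH].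
  rewrite scale0r (_ : (fun y => _) = cst (1 : cl)); last by apply/funext => y.
  exact: is_derive_cst.
rewrite (_ : (fun y => _) = (fun y => f y * f y ^+ k)); last first.
  by apply/funext => y; rewrite exprS.
apply: is_derive_eq (is_derive_clifford_mul fd IH) _.
rewrite -scalerAr mulrA -exprS /= (commrX k (commr_sym cf)).
case: k {IH} => [|k] /=; first by rewrite scale0r addr0 scale1r.
by rewrite -[k.+2]addn1 natrD scalerDl scale1r addrC.
Qed.

Lemma differentiable_clifford_mul (V : normedModType R) (f g : V -> cl) x :
  differentiable f x -> differentiable g x ->
  differentiable (fun y => f y * g y) x.
Proof.
move=> df dg.
apply: (@differentiable_comp _ _ _ _ (fun y => (f y, g y))
  (fun p : cl * cl => p.1 * p.2)).
  exact: differentiable_pair.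
exact: (@differentiable_bilin _ cl cl cl (@clifford_mul R n) (f x, g x)
  (@clifford_mul_continuous)).
Qed.

Lemma differentiable_clifford_exp (V : normedModType R) (f : V -> cl) x k :
  differentiable f x -> differentiable (fun y => f y ^+ k) x.
Proof.
move=> df; elim: k => [|k IH].
  rewrite (_ : (fun y => _) = cst (1 : cl)); last by apply/funext => y.
  exact: differentiable_cst.
rewrite (_ : (fun y => _) = (fun y => f y * f y ^+ k)); last first.
  by apply/funext => y; rewrite exprS.
exact: differentiable_clifford_mul.
Qed.

End CliffordCalculus.

(** * Paravectors and their conjugates *)

Section ParavectorAlgebra.
Variable R : realType.

(** Adding the double sum to its transpose cancels the off-diagonal terms by anticommutation; the
    resulting factor 2 is then removed. Only the defining relations enter, so the blade model stays
    out of sight. *)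
Lemma sqr_anticomm_sum (A : algType R) (n : nat) (e : 'I_n -> A) (c : 'I_n -> R) :
  (forall l, e l * e l = -1) ->
  (forall l k, l != k -> e l * e k + e k * e l = 0) ->
  (\sum_l c l *: e l) * (\sum_l c l *: e l) = - (\sum_l c l ^+ 2)%:A.
Proof.
move=> e2 anti.
have dbl (y z : A) : y + y = z + z -> y = z.
  have half (u : A) : u = 2^-1 *: (u + u).
    by rewrite -[u + u]mulr2n -[u *+ 2]scaler_nat scalerA mulVf ?pnatr_eq0// scale1r.
  by move=> yz; rewrite (half y) (half z) yz.
have -> : (\sum_l c l *: e l) * (\sum_l c l *: e l) =
    \sum_l \sum_k (c l * c k) *: (e l * e k).
  rewrite mulr_suml; apply: eq_bigr => l _; rewrite mulr_sumr.
  by apply: eq_bigr => k _; rewrite -scalerAl -scalerAr scalerA.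
apply: dbl; rewrite [X in _ + X = _]exchange_big -big_split /=.
rewrite scaler_suml -sumrN -big_split /=.
apply: eq_bigr => l _; rewrite -big_split /= (bigD1 l) //= big1 ?addr0.
  by rewrite e2 -expr2 scalerN.
by move=> k kl; rewrite [c k * _]mulrC -scalerDr anti ?scaler0// eq_sym.
Qed.

Lemma alg_mul_conj (A : algType R) (a : R) (w : A) :
  (a%:A + w) * (a%:A - w) = (a ^+ 2)%:A - w * w.
Proof.
rewrite mulrDl !mulrBr !mulr_algl mulr_algr scalerA -expr2 addrA.
by rewrite subrK.
Qed.

Variable n : nat.
Notation pt := 'rV[R]_n.+1.
Notation cl := (clifford R n).
Implicit Types x : pt.

(** Reduces identities between real linear combinations of Clifford elements to identities over R,
    which [ring] decides. *)
Lemma clifford_coef_inj (x y : cl) :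
  (forall A, clifford_coef x A = clifford_coef y A) -> x = y.
Proof.
move=> xy; rewrite (clifford_expand x) (clifford_expand y).
by apply: eq_bigr => A _; rewrite xy.
Qed.

Lemma clifford_coefN (x : cl) A : clifford_coef (- x) A = - clifford_coef x A.
Proof. exact: mxE. Qed.

Definition sqnorm x : R := \sum_i x 0 i ^+ 2.

Lemma vector_part_sqr x :
  vector_part x * vector_part x = - (\sum_(l < n) x 0 (lift ord0 l) ^+ 2)%:A.
Proof.
apply: sqr_anticomm_sum; [exact: clifford_gen_sqr|exact: clifford_gen_anticomm].
Qed.

(** Up to a real number xbar is -x, so it commutes with x and inherits linearity and
    differentiability. *)
Lemma paraconjE x : paraconj x = (2 * x 0 0)%:A - paravector x.
Proof.
by rewrite /paraconj /paravector opprD addrA -scalerBl mulr_natl mulr2n addrK.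
Qed.

Lemma paravector_add_conj x : paravector x + paraconj x = (2 * x 0 0)%:A.
Proof. by rewrite paraconjE addrC subrK. Qed.

Lemma paravector_comm_conj x : GRing.comm (paravector x) (paraconj x).
Proof.
rewrite paraconjE; apply: commrB; last exact: commr_refl.
by rewrite /GRing.comm mulr_algl mulr_algr.
Qed.

Lemma paravector_mul_conj x : paravector x * paraconj x = (sqnorm x)%:A.
Proof.
rewrite /paravector /paraconj alg_mul_conj vector_part_sqr opprK -scalerDl.
by congr (_%:A); rewrite /sqnorm big_ord_recl.
Qed.

Lemma paravector_linear h (x y : pt) :
  paravector (h *: x + y) = h *: paravector x + paravector y.
Proof.
rewrite /paravector /vector_part !mxE scalerDl scalerDr scalerA -!addrA.
congr (_ + _); rewrite addrCA; congr (_ + _).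
rewrite scaler_sumr -big_split /=; apply: eq_bigr => l _.
by rewrite !mxE scalerDl scalerA.
Qed.

Lemma paraconj_linear h (x y : pt) :
  paraconj (h *: x + y) = h *: paraconj x + paraconj y.
Proof.
rewrite !paraconjE paravector_linear !mxE opprD scalerBr scalerA.
by rewrite mulrDr scalerDl mulrCA -!addrA; congr (_ + _); rewrite addrCA.
Qed.

Lemma paravectorZ h x : paravector (h *: x) = h *: paravector x.
Proof.
have p0 : paravector (0 : pt) = 0.
  by have := paravector_linear (-1) 0 0; rewrite scaler0 addr0 scaleN1r addNr.
by rewrite -[h *: x]addr0 paravector_linear p0 addr0.
Qed.

Lemma paravector_delta0 : paravector (delta_mx 0 0 : pt) = 1.
Proof.
rewrite /paravector mxE eqxx scale1r /vector_part big1 ?addr0// => i _.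
by rewrite mxE scale0r.
Qed.

End ParavectorAlgebra.

(** * Iterated Laplacians of the powers of a paravector *)

Section GegenbauerSeries.
Variables (R : realType) (n : nat).
Notation pt := 'rV[R]_n.+1.
Notation cl := (clifford R n).
Implicit Types x : pt.

(** Multiplication by t of the series with coefficients [a]. *)
Definition series_shift (V : nmodType) (a : nat -> V) (d : nat) : V :=
  if d is d'.+1 then a d' else 0.

(** The coefficient of t^s in (1 - t)^(-a). *)
Definition rising (a s : nat) : R := pochhammer a%:R s / s`!%:R.

Lemma rising0 a : rising a 0 = 1.
Proof. by rewrite /rising /pochhammer big_ord0 divr1. Qed.

Lemma rising0l s : rising 0 s = (s == 0)%:R.
Proof.
case: s => [|s]; first exact: rising0.
by rewrite /rising /pochhammer big_ord_recl add0r !mul0r.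
Qed.

(** The identity (1 - t) (1 - t)^(-a-1) = (1 - t)^(-a) in degree s + 1. *)
Lemma risingS a s : rising a.+1 s.+1 = rising a s.+1 + rising a.+1 s.
Proof.
have f0 : s`!%:R != 0 :> R by rewrite pnatr_eq0 -lt0n fact_gt0.
have s0 : s%:R + 1 != 0 :> R by rewrite natr1 pnatr_eq0.
have eqS : pochhammer a%:R s.+1 = a%:R * pochhammer (a.+1%:R : R) s.
  rewrite /pochhammer big_ord_recl addr0; congr (_ * _).
  by apply: eq_bigr => i _; rewrite /= /bump /= add1n -!natr1 addrAC addrA.
have eqS' : pochhammer a.+1%:R s.+1 = pochhammer (a.+1%:R : R) s * (a%:R + 1 + s%:R).
  by rewrite /pochhammer big_ord_recr /= natr1.
rewrite /rising eqS eqS' factS natrM -[s.+1%:R]natr1.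
by field; rewrite f0.
Qed.

Lemma rising1 s : rising 1 s = 1.
Proof. by elim: s => [|s IH]; rewrite ?rising0// risingS rising0l IH add0r. Qed.

(* The coefficient of [t^d] in [(1 - x t)^(-a) (1 - xbar t)^(-b)]. *)
Definition biseries (a b d : nat) x : cl :=
  \sum_(s < d.+1) (rising a (d - s) * rising b s) *:
    (paravector x ^+ (d - s) * paraconj x ^+ s).

(** Multiplying by 1 - x t removes one of the a + 1 factors (1 - x t)^(-1). *)
Lemma biseriesSl a b d x :
  biseries a.+1 b d x =
  biseries a b d x + paravector x * series_shift (fun d => biseries a.+1 b d x) d.
Proof.
case: d => [|d].
  by rewrite /biseries !big_ord1 subn0 !rising0 mulr0 addr0.
rewrite /= {1 2}/biseries big_ord_recr [in RHS]big_ord_recr /= subnn !rising0.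
rewrite [RHS]addrAC; congr (_ + _).
rewrite mulr_sumr -big_split /=; apply: eq_bigr => s _.
have sd : (s <= d)%N by rewrite -ltnS ltn_ord.
rewrite subSn // risingS mulrDl scalerDl; congr (_ + _).
by rewrite -[RHS]scalerAr; congr (_ *: _); rewrite mulrA -exprS.
Qed.

(** The same for 1 - xbar t; here xbar has to be moved past the powers of x. *)
Lemma biseriesSr a b d x :
  biseries a b.+1 d x =
  biseries a b d x + paraconj x * series_shift (fun d => biseries a b.+1 d x) d.
Proof.
case: d => [|d].
  by rewrite /biseries !big_ord1 subn0 !rising0 mulr0 addr0.
rewrite /= {1 2}/biseries big_ord_recl [in RHS]big_ord_recl /= !rising0 -addrA.
congr (_ + _); rewrite mulr_sumr -big_split /=; apply: eq_bigr => s _.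
rewrite /bump /= add1n subSS risingS mulrDr scalerDl; congr (_ + _).
rewrite -[RHS]scalerAr; congr (_ *: _); rewrite exprS !mulrA.
by rewrite (commrX _ (commr_sym (paravector_comm_conj x))).
Qed.

(** The coefficient of t^d in D^(-l): the Gegenbauer polynomial of degree d and parameter l in
    x_0/|x|, made homogeneous by |x|^d. *)
Definition gegen (l d : nat) x : cl := biseries l l d x.

(** The coefficient of t^d in q_r. *)
Definition fueter_series (r d : nat) x : cl := biseries r.+1 r d x.

(** This is D D^(-l-1) = D^(-l) with D = 1 - (x + xbar) t + x xbar t^2; the two linear factors of D
    are peeled off in turn. *)
Lemma gegenS l d x :
  gegen l.+1 d x = gegen l d x + (2 * x 0 0) *: series_shift (fun d => gegen l.+1 d x) d
     - sqnorm x *: series_shift (series_shift (fun d => gegen l.+1 d x)) d.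
Proof.
rewrite /gegen biseriesSl biseriesSr -addrA -[RHS]addrA; congr (_ + _).
rewrite -[_ *: series_shift _ _]mulr_algl.
rewrite -[_ *: series_shift (series_shift _) _]mulr_algl.
rewrite -paravector_add_conj -paravector_mul_conj.
case: d => [|d] /=; first by rewrite !mulr0 subr0 addr0.
have -> : biseries l l.+1 d x = biseries l.+1 l.+1 d x
    - paravector x * series_shift (fun d => biseries l.+1 l.+1 d x) d.
  by rewrite [X in _ = X - _]biseriesSl addrK.
rewrite mulrBr [X in _ = X - _]mulrDl mulrA (paravector_comm_conj x) addrAC.
by congr (_ - _); rewrite addrC.
Qed.

Lemma fueter_seriesE r d x :
  fueter_series r d x =
  gegen r.+1 d x - paraconj x * series_shift (fun d => gegen r.+1 d x) d.
Proof. by rewrite /gegen biseriesSr addrK. Qed.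

Lemma fueter_series0 d x : fueter_series 0 d x = paravector x ^+ d.
Proof.
rewrite /fueter_series /biseries (bigD1 ord0) //= big1 ?addr0.
  by rewrite subn0 expr0 mulr1 rising1 rising0 mulr1 scale1r.
move=> s /negPf s0; rewrite rising0l -[(_ == _)]/(s == ord0) s0.
by rewrite mulr0 scale0r.
Qed.

(** The coefficient of t^d in t^k D^(-l). With the shift as a parameter, recurrences and derivatives
    need no separate cases for small d. *)
Definition sgegen (k l d : nat) x : cl :=
  iter k (@series_shift cl) (fun d => gegen l d x) d.

Arguments sgegen : simpl never.

Lemma sgegenS k l d x :
  sgegen k l.+1 d x = sgegen k l d x + (2 * x 0 0) *: sgegen k.+1 l.+1 d x
    - sqnorm x *: sgegen k.+2 l.+1 d x.
Proof.
elim: k d => [|k IH] d; first exact: gegenS.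
case: d => [|d]; last exact: IH.
by rewrite /sgegen /= !scaler0 subr0 addr0.
Qed.

Lemma gegen0 d x : gegen 0 d x = (d == 0)%:R.
Proof.
rewrite /gegen /biseries (bigD1 ord0) //= big1 ?addr0 => [|s /negPf s0].
  rewrite subn0 !rising0l mulr1 expr0 mulr1.
  by case: d => [|d]; rewrite ?scale0r// scale1r expr0.
by rewrite (rising0l s) -[(_ == _)]/(s == ord0) s0 mulr0 scale0r.
Qed.

(** * Derivatives and Laplacian of D^(-l) *)

Lemma is_derive_coord i j x :
  is_derive x (delta_mx 0 i) (fun y : pt => y 0 j) (i == j)%:R.
Proof.
by apply: is_derive_affine => h; rewrite !mxE eqxx [j == i]eq_sym.
Qed.

Lemma is_derive_coordM (k : R) i j x :
  is_derive x (delta_mx 0 i) (fun y : pt => k * y 0 j) (k * (i == j)%:R).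
Proof. by have ? := is_derive_coord i j x; apply: is_deriveZ. Qed.

Lemma is_derive_sqnorm i x : is_derive x (delta_mx 0 i) (@sqnorm R n) (2 * x 0 i).
Proof.
rewrite (_ : @sqnorm R n = \sum_j (fun y : pt => y 0 j) ^+ 2); last first.
  by apply/funext => y; rewrite fct_sumE.
have ? := is_derive_coord i.
apply: is_derive_eq.
rewrite (bigD1 i) //= big1 ?addr0 => [|j /negPf ji].
  by rewrite eqxx scaler1 expr1 mulr_natl.
by rewrite eq_sym ji scaler0.
Qed.

(* With [D = 1 - 2 x_0 t + |x|^2 t^2], this is
   [d_i D^(-l) = l (2 delta_(i0) t - 2 x_i t^2) D^(-l-1)] shifted by [t^k]. *)
Definition dgegen (k l d : nat) (i : 'I_n.+1) x : cl :=
  l%:R *: ((2 * (i == 0)%:R) *: sgegen k.+1 l.+1 d x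
           - (2 * x 0 i) *: sgegen k.+2 l.+1 d x).

(** The hypothesis stops at degree d - k because it will be supplied by a strong induction on the
    degree. *)
Lemma is_derive_sgegen_le k l d i x :
  (forall d', (d' + k <= d)%N ->
     is_derive x (delta_mx 0 i) (gegen l d') (dgegen 0 l d' i x)) ->
  is_derive x (delta_mx 0 i) (sgegen k l d) (dgegen k l d i x).
Proof.
elim: k d => [|k IH] d H; first by apply: H; rewrite addn0.
case: d H => [|d] H.
  rewrite /dgegen /sgegen /= !scaler0 subr0 scaler0; exact: is_derive_cst.
by apply: IH => d' d'd; apply: H; rewrite addnS.
Qed.

(** Double induction on the recurrence [gegenS]: its unshifted term has the smaller exponent l, and
    its shifted terms keep l + 1 but have smaller degree. *)
Lemma is_derive_gegen l d i x :
  is_derive x (delta_mx 0 i) (gegen l d) (dgegen 0 l d i x).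
Proof.
elim: l d => [|l IHl] d.
  rewrite /dgegen scale0r (_ : gegen 0 d = cst (d == 0)%:R).
    exact: is_derive_cst.
  by apply/funext => y; rewrite gegen0.
elim/ltn_ind: d => d IHd.
have H k : is_derive x (delta_mx 0 i) (sgegen k.+1 l.+1 d)
    (dgegen k.+1 l.+1 d i x).
  apply: is_derive_sgegen_le => d' d'd; apply: IHd.
  by rewrite (leq_trans _ d'd)// addnS ltnS leq_addr.
rewrite (_ : gegen l.+1 d = fun y => gegen l d y
    + (2 * y 0 0) *: sgegen 1 l.+1 d y - sqnorm y *: sgegen 2 l.+1 d y).
  have H1 := is_derive_scale (is_derive_coordM 2 i 0 x) (H 0%N).
  have H2 := is_derive_scale (is_derive_sqnorm i x) (H 1%N).
  apply: (is_derive_eq (is_deriveB (is_deriveD (IHl d) H1) H2)).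
  (* Expanding D^(-l-2) on the right by the recurrence leaves the same shifted coefficients on both
     sides, and the claim is linear in them. *)
  rewrite /dgegen [X in _ = _ *: (_ *: X - _)]sgegenS.
  rewrite [X in _ = _ *: (_ - _ *: X)]sgegenS.
  apply: clifford_coef_inj => A.
  by rewrite !(clifford_coefD, clifford_coefN, clifford_coefZ); ring.
by apply/funext => y; exact: gegenS.
Qed.

Lemma is_derive_sgegen k l d i x :
  is_derive x (delta_mx 0 i) (sgegen k l d) (dgegen k l d i x).
Proof. by apply: is_derive_sgegen_le => d' _; exact: is_derive_gegen. Qed.

Definition ddgegen (k l d : nat) (i : 'I_n.+1) x : cl :=
  l%:R *: ((2 * (i == 0)%:R) *: dgegen k.+1 l.+1 d i x
           - (2 *: sgegen k.+2 l.+1 d x + (2 * x 0 i) *: dgegen k.+2 l.+1 d i x)).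

Lemma is_derive_dgegen k l d i x :
  is_derive x (delta_mx 0 i) (dgegen k l d i) (ddgegen k l d i x).
Proof.
have H1 := is_derive_sgegen k.+1 l.+1 d i x.
have := is_derive_scale (is_derive_coordM 2 i i x)
  (is_derive_sgegen k.+2 l.+1 d i x).
rewrite eqxx mulr1 => H2.
exact: (is_deriveZ _ (is_deriveB (is_deriveZ _ H1) H2)).
Qed.

Lemma sum_delta0 (a : 'I_n.+1 -> R) : \sum_i (i == 0)%:R * a i = a 0.
Proof.
rewrite (bigD1 0) //= big1 ?addr0 ?mul1r// => i /negPf ->; exact: mul0r.
Qed.

(* [Lap D^(-l) = 2 l (2 l + 1 - n) t^2 D^(-l-1)], because [|grad D|^2 = 4 t^2 D]. *)
Lemma sum_ddgegen k l d x :
  \sum_i ddgegen k l d i x =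
  (2 * l%:R * (2 * l%:R + 1 - n%:R)) *: sgegen k.+2 l.+1 d x.
Proof.
have E i : ddgegen k l d i x =
    (4 * l%:R * l.+1%:R * ((i == 0)%:R * 1)) *: sgegen k.+2 l.+2 d x
    - (8 * l%:R * l.+1%:R * ((i == 0)%:R * x 0 i)) *: sgegen k.+3 l.+2 d x
    + (4 * l%:R * l.+1%:R * x 0 i ^+ 2) *: sgegen k.+4 l.+2 d x
    - (2 * l%:R) *: sgegen k.+2 l.+1 d x.
  apply: clifford_coef_inj => A; rewrite /ddgegen /dgegen.
  rewrite !(clifford_coefD, clifford_coefN, clifford_coefZ).
  by case: (i == 0) => /=; ring.
under eq_bigr do rewrite E.
rewrite sumrB big_split /= sumrB -!scaler_suml -!mulr_sumr !sum_delta0.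
have -> (v : R) : \sum_(i < n.+1) v = n.+1%:R * v.
  by rewrite sumr_const card_ord mulr_natl.
(* Up to t^k the first three sums form 4 l (l + 1) t^2 D D^(-l-2), which collapses to t^2 D^(-l-1);
   the n + 1 copies of the last term subtract 2 l (n + 1). *)
rewrite -/(sqnorm x) [sgegen k.+2 l.+2 d x]sgegenS.
apply: clifford_coef_inj => A.
rewrite !(clifford_coefD, clifford_coefN, clifford_coefZ).
by rewrite -[_ *: l%:R]/(_ * _); ring.
Qed.

(** * Laplacian of q_r and its iterates *)

Definition dfueter (r d : nat) (i : 'I_n.+1) x : cl :=
  dgegen 0 r.+1 d i x - (paraconj (delta_mx 0 i) * sgegen 1 r.+1 d x
     + paraconj x * dgegen 1 r.+1 d i x).

Lemma is_derive_fueter r d i x :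
  is_derive x (delta_mx 0 i) (fueter_series r d) (dfueter r d i x).
Proof.
rewrite (_ : fueter_series r d =
    fun y => gegen r.+1 d y - paraconj y * sgegen 1 r.+1 d y); last first.
  by apply/funext => y; exact: fueter_seriesE.
apply: is_deriveB; first exact: is_derive_gegen.
apply: is_derive_clifford_mul; last exact: is_derive_sgegen.
by apply: is_derive_affine => h; exact: paraconj_linear.
Qed.

Definition ddfueter (r d : nat) (i : 'I_n.+1) x : cl :=
  ddgegen 0 r.+1 d i x - (paraconj (delta_mx 0 i) * dgegen 1 r.+1 d i x
     + (paraconj (delta_mx 0 i) * dgegen 1 r.+1 d i x
        + paraconj x * ddgegen 1 r.+1 d i x)).

Lemma is_derive_dfueter r d i x :
  is_derive x (delta_mx 0 i) (dfueter r d i) (ddfueter r d i x).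
Proof.
have dc : is_derive x (delta_mx 0 i) (@paraconj R n) (paraconj (delta_mx 0 i)).
  by apply: is_derive_affine => h; exact: paraconj_linear.
apply: is_deriveB; first exact: is_derive_dgegen.
apply: is_deriveD; last first.
  by apply: is_derive_clifford_mul; last exact: is_derive_dgegen.
have := is_derive_clifford_mul
  (is_derive_cst (paraconj (delta_mx 0 i)) x (delta_mx 0 i))
  (is_derive_sgegen 1 r.+1 d i x).
by rewrite mul0r add0r.
Qed.

(** The cross term of the Laplacian of a product with xbar. Weighting 2 delta_(i0) t - 2 x_i t^2 by
    conj(e_i) and summing gives 2 t (1 - xbar t), because sum_i x_i conj(e_i) = xbar. *)
Lemma sum_conj_dgegen k l d x :
  \sum_(i < n.+1) paraconj (delta_mx 0 i) * dgegen k.+1 l d i x =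
  (2 * l%:R) *: (sgegen k.+2 l.+1 d x - paraconj x * sgegen k.+3 l.+1 d x).
Proof.
have pl (h : R) (y z : pt) := paraconj_linear h y z.
have p0 : paraconj (0 : pt) = 0.
  by have := pl (-1) 0 0; rewrite scaler0 addr0 scaleN1r addNr.
have sumc (a : 'I_n.+1 -> R) :
    \sum_i a i *: paraconj (delta_mx 0 i) = paraconj (\row_i a i).
  rewrite (row_sum_delta (\row_i a i)); apply: esym.
  rewrite (big_morph (@paraconj R n) (id1 := 0) (op1 := +%R)) //.
    by apply: eq_bigr => i _; rewrite mxE -[_ *: delta_mx _ _]addr0 pl p0 addr0.
  by move=> y z; rewrite -[y]scale1r pl !scale1r.
have E i : paraconj (delta_mx 0 i) * dgegen k.+1 l d i x =
    (2 * l%:R) *: (((i == 0)%:R *: paraconj (delta_mx 0 i)) * sgegen k.+2 l.+1 d x)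
    - (2 * l%:R) *: ((x 0 i *: paraconj (delta_mx 0 i)) * sgegen k.+3 l.+1 d x).
  rewrite /dgegen; set c := paraconj _.
  set u := sgegen _ _ _ _; set v := sgegen _ _ _ _.
  rewrite -scalerAr mulrBr -!scalerAr -!scalerAl scalerBr !scalerA.
  by congr (_ *: _ - _ *: _); ring.
under eq_bigr do rewrite E.
rewrite sumrB -!scaler_sumr -!mulr_suml !sumc -scalerBr.
have -> : \row_i x 0 i = x by apply/rowP => i; rewrite mxE.
have -> : paraconj (\row_i (i == 0)%:R : pt) = 1.
  rewrite /paraconj mxE eqxx scale1r /vector_part big1 ?subr0// => i _.
  by rewrite mxE scale0r.
by rewrite mul1r.
Qed.

Lemma sum_ddfueter r d x :
  \sum_i ddfueter r d i x =
  (2 * r.+1%:R * (2 * r%:R + 1 - n%:R)) *: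
    series_shift (series_shift (fun d => fueter_series r.+1 d x)) d.
Proof.
(* This is t^2 q_(r+1) = t^2 D^(-r-2) - xbar t^3 D^(-r-2), the form in which the sums below come
   out. *)
have -> : series_shift (series_shift (fun d => fueter_series r.+1 d x)) d =
    sgegen 2 r.+2 d x - paraconj x * sgegen 3 r.+2 d x.
  rewrite /sgegen; case: d => [|[|d]] /=; rewrite ?mulr0 ?subr0//.
  exact: fueter_seriesE.
rewrite /ddfueter sumrB big_split big_split /=.
rewrite -mulr_sumr.
rewrite [X in X - _]sum_ddgegen [X in _ - (X + _)]sum_conj_dgegen.
rewrite [X in _ - (_ + (X + _))]sum_conj_dgegen.
rewrite [X in _ - (_ + (_ + _ * X))]sum_ddgegen.
rewrite -scalerAr.
set u := _ * sgegen 3 _ _ _.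
apply: clifford_coef_inj => A.
by rewrite !(clifford_coefD, clifford_coefN, clifford_coefZ); ring.
Qed.

Lemma laplacian_fueter_series (c : R) r d :
  laplacian (fun x => c *: fueter_series r d x) =
  fun x => (c * (2 * r.+1%:R * (2 * r%:R + 1 - n%:R))) *:
    series_shift (series_shift (fun d => fueter_series r.+1 d x)) d.
Proof.
apply/funext => x; rewrite -scalerA -sum_ddfueter scaler_sumr.
apply: eq_bigr => i _; rewrite /partial.
(* The inner derivative has to be identified as a function before it can be differentiated again. *)
have -> : (fun x => 'D_(delta_mx 0 i) (fun x => c *: fueter_series r d x) x) =
    fun x => c *: dfueter r d i x.
  apply/funext => y.
  by have [_ <-] := is_deriveZ c (is_derive_fueter r d i y).
by have [_ <-] := is_deriveZ c (is_derive_dfueter r d i x).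
Qed.

(** The guard is needed since truncated subtraction would otherwise give degree 0, where q_r has
    coefficient 1, for every j < 2 r. *)
Lemma iter_laplacian_paravector r j :
  iter r (@laplacian R n) (fun x => paravector x ^+ j) =
  fun x => (if (r.*2 <= j)%N
            then \prod_(i < r) (2 * i.+1%:R * (2 * i%:R + 1 - n%:R)) else 0) *:
    fueter_series r (j - r.*2) x.
Proof.
elim: r => [|r IH].
  by apply/funext => x /=; rewrite big_ord0 scale1r subn0 fueter_series0.
rewrite iterS IH laplacian_fueter_series; apply/funext => x.
rewrite big_ord_recr /= doubleS; case: (leqP r.*2.+2 j) => rj.
  rewrite (leq_trans _ rj) ?leqW//.
  by have -> : (j - r.*2 = (j - r.*2.+2).+2)%N by lia.
rewrite scale0r; case: leqP => rj2; last by rewrite mul0r scale0r.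
(* The remaining degree is 0 or 1, and multiplication by t^2 leaves no coefficient there. *)
have : (j - r.*2 < 2)%N by rewrite ltn_subLR// addn2.
by case: (j - r.*2)%N => [|[|]] //= _; rewrite scaler0.
Qed.

(** For n = 2 N + 1 one has 2 i + 1 - n = -2 (N - i), so each factor is -4 (i + 1) (N - i), and both
    i + 1 and N - i run through 1, ..., N. *)
Lemma prod_fueter_coef N : n = N.*2.+1 ->
  \prod_(i < N) (2 * i.+1%:R * (2 * i%:R + 1 - n%:R)) =
  (-1) ^+ N * 4 ^+ N * N`!%:R ^+ 2 :> R.
Proof.
move=> nE.
have P1 : \prod_(i < N) i.+1%:R = N`!%:R :> R.
  by rewrite -natr_prod; congr (_%:R); elim: N {nE} => [|N IH];
     rewrite ?big_ord0// big_ord_recr /= IH factS mulnC.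
have P2 : \prod_(i < N) (N - i)%:R = N`!%:R :> R.
  rewrite -P1 (reindex_inj rev_ord_inj) /=; apply: eq_bigr => i _.
  by rewrite subKn.
rewrite (eq_bigr (fun i : 'I_N => (-1 * 4) * (i.+1%:R * (N - i)%:R))).
  rewrite big_split prodr_const card_ord exprMn big_split /= P1 P2.
  by rewrite expr2.
move=> i _; rewrite natrB ?(ltnW (ltn_ord i))//.
have -> : n%:R = 2 * N%:R + 1 :> R by rewrite nE -natr1 -muln2 natrM mulrC.
by ring.
Qed.

(** Here (n + 1)/2 = N + 1 and (n - 1)/2 = N are the two exponents in q_N; the binomial in T_s^p(n)
    accounts for the factorials and the prefactor cancels its denominator (n)_p. *)
Lemma fueter_series_appell N p x : n = N.*2.+1 ->
  fueter_series N p x =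
  (pochhammer n%:R p / p`!%:R) *: clifford_appell p x.
Proof.
move=> nE; rewrite /clifford_appell scaler_sumr; apply: eq_bigr => s _.
rewrite scalerA; congr (_ *: _).
have poch0 q : pochhammer (n%:R : R) q != 0.
  by rewrite /pochhammer prodf_seq_neq0; apply/allP => i _ /=;
     rewrite nE -natrD pnatr_eq0 addSn.
have sp : (s <= p)%N by rewrite -ltnS ltn_ord.
have nz q : q`!%:R != 0 :> R by rewrite pnatr_eq0 -lt0n fact_gt0.
have two : 2 != 0 :> R by rewrite pnatr_eq0.
rewrite /appell_coef /rising -(bin_fact sp) !natrM.
have -> : (n%:R + 1) / 2 = N.+1%:R :> R by rewrite nE -muln2 -!natr1 natrM; field.
have -> : (n%:R - 1) / 2 = N%:R :> R by rewrite nE -muln2 -!natr1 natrM; field.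
have bn0 : 'C(p, s)%:R != 0 :> R by rewrite pnatr_eq0 -lt0n bin_gt0.
by field; rewrite poch0 bn0 !nz.
Qed.

End GegenbauerSeries.

(** * The Gamma function at positive integers *)

(** One term of the exponential series gives e^t >= t^(k+1)/(k+1)!, hence t^k e^(-t) <= (k+1)!/t. *)
Lemma cvg_expn_expRN (R : realType) (k : nat) :
  (t ^+ k * expR (- t)) @[t --> +oo%R] --> (0 : R).
Proof.
apply/cvgrPdist_le => e e0; near=> t.
have t0 : 0 < t by near: t; exact: nbhs_pinfty_gt.
rewrite sub0r normrN ger0_norm; last by rewrite mulr_ge0 ?exprn_ge0 ?expR_ge0 ?ltW.
rewrite expRN ler_pdivrMr ?expR_gt0//.
have h1 : t ^+ k.+1 <= (k.+1)`!%:R * expR t.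
  rewrite mulrC -ler_pdivrMr ?ltr0n ?fact_gt0//.
  by apply: le_trans (expR_ge1Dxn k (ltW t0)); rewrite lerDr.
rewrite -(ler_pM2l t0) -exprS; apply: le_trans h1 _.
rewrite mulrA ler_pM2r ?expR_gt0// -(ler_pdivrMr _ _ e0).
by near: t; apply: nbhs_pinfty_ge; exact: num_real.
Unshelve. all: by end_near. Qed.

(* [- e^(-t) * S t] is the primitive of [t^N e^(-t)], where
   [S t = \sum_k (N`! / k`!) t^k] satisfies [S - S' = t^N]. *)
Lemma Gamma_nat (R : realType) (N : nat) : Gamma (N%:R + 1 : R) = N`!%:R.
Proof.
pose S (N : nat) (t : R) : R := \sum_(k < N.+1) (N`!%:R / k`!%:R) * t ^+ k.
(* Through this recurrence S - S' = t^M follows by induction on M. *)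
have SS M (t : R) : S M.+1 t = t ^+ M.+1 + M.+1%:R * S M t.
  rewrite /S big_ord_recr /= divff ?pnatr_eq0 -?lt0n ?fact_gt0// mul1r addrC.
  congr (_ + _); rewrite mulr_sumr; apply: eq_bigr => k _.
  by rewrite factS natrM !mulrA.
have dS M (t : R) : is_derive t (1 : R) (S M) (S M t - t ^+ M).
  elim: M => [|M IH].
    rewrite (_ : S 0%N = cst 1); last first.
      by apply/funext => u; rewrite /S big_ord1 expr0 divff ?mulr1 ?oner_eq0.
    by rewrite expr0 subrr; exact: is_derive_cst.
  rewrite (_ : S M.+1 = (@id R) ^+ M.+1 + M.+1%:R *: S M); last first.
    by apply/funext => u; rewrite SS; congr (_ + _); rewrite fctE.
  apply: is_derive_eq (is_deriveD (is_deriveX M.+1 (is_derive_id t 1))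
    (is_deriveZ M.+1%:R IH)) _.
  rewrite -[(_ + _ : R -> R) t]/(_ t + _ t) -[(_ *: _ : R -> R) t]/(_ * _ t).
  rewrite -![_ *: _]/(_ * _) /= fctE.
  ring.
pose F (t : R) := - (expR (- t) * S N t).
have dF (t : R) : is_derive t (1 : R) F (t ^+ N * expR (- t)).
  have de : is_derive t (1 : R) (expR \o -%R) (expR (- t) * - 1).
    exact: is_derive1_comp.
  rewrite (_ : F = - ((expR \o -%R) * S N)); last exact/funext.
  have ? := dS N t.
  apply: is_derive_eq.
  rewrite -![_ *: _]/(_ * _) /=; ring.
have Flim : F x @[x --> +oo%R] --> (0 : R).
  rewrite -oppr0; apply: cvgN.
  rewrite (_ : (fun t => _) =
     fun t => \sum_(k < N.+1) (N`!%:R / k`!%:R) * (t ^+ k * expR (- t))); last first.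
    apply/funext => t; rewrite mulr_sumr; apply: eq_bigr => k _; ring.
  rewrite [X in _ --> X](_ : 0 = \sum_(k < N.+1) 0); last by rewrite big1.
  apply: cvg_big => [|k _]; first exact: add_continuous.
  rewrite -(mulr0 (N`!%:R / k`!%:R : R)).
  by apply: cvgMl_tmp; exact: cvg_expn_expRN.
have Fcont : continuous F.
  by move=> t; apply/differentiable_continuous/derivable1_diffP; have [] := dF t.
pose f (t : R) := t ^+ N * expR (- t).
have fcont : continuous f.
  move=> t; apply: cvgM; first exact: exprn_continuous.
  by apply: continuous_comp; [exact: opp_continuous|exact: continuous_expR].
have -> : Gamma (N%:R + 1 : R) = \int[lebesgue_measure]_(t in `]0, +oo[) f t.
  apply: eq_Rintegral => t; rewrite inE /= in_itv/= andbT => t0.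
  by rewrite addrK powR_mulrn // ltW.
(* Closing the endpoint, a null set, prepares for the fundamental theorem of calculus on [0,
   +oo[. *)
have -> : \int[lebesgue_measure]_(t in `]0, +oo[) f t =
   \int[lebesgue_measure]_(t in `[0, +oo[) f t.
  rewrite /Rintegral integral_itv_obnd_cbnd//.
  apply/measurable_EFinP/measurable_funTS.
  exact: continuous_measurable_fun.
rewrite (@Rintegral_ge0_continuous_FTC2y _ f F 0 0) //.
(* The integral is 0 - F 0, and at 0 only the constant term N! of S survives. *)
- rewrite sub0r opprK oppr0 expR0 mul1r /S (bigD1 ord0) //= big1 ?addr0.
    by rewrite expr0 mulr1 divr1.
  by move=> i /negPf i0; rewrite expr0n -[(_ == _)]/(i == ord0) i0 mulr0.
- by move=> t t0; rewrite mulr_ge0 ?exprn_ge0 ?expR_ge0.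
- exact: continuous_subspaceT.
- by apply: cvg_at_right_filter; exact: Fcont.
- by move=> t _; rewrite derive1E; apply: derive_val.
Qed.

(** * Slices and polyanalytic components *)

Section SliceCalculus.
Variables (R : realType) (n : nat).
Notation pt := 'rV[R]_n.+1.
Notation cl := (clifford R n).
Implicit Types I x : pt.

(** Along an affine parametrization the two difference quotients are the same function of h; this
    turns directional derivatives into derivatives in u or v on a slice. *)
Lemma is_derive_line (V W : normedModType R) (g : V -> W) (phi : R -> V) w t :
  (forall h, phi (h *: 1 + t) = h *: w + phi t) -> derivable g (phi t) w ->
  is_derive t (1 : R) (g \o phi) ('D_w g (phi t)).
Proof.
move=> phiE dg.
have E : (fun h => h^-1 *: (((g \o phi) \o shift t) (h *: 1) - (g \o phi) t)) =
    (fun h => h^-1 *: ((g \o shift (phi t)) (h *: w) - g (phi t))).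
  by apply/funext => h; rewrite /= phiE.
by split; [rewrite /derivable E|rewrite /derive E].
Qed.

Lemma is_derive_derive1 (W : normedModType R) (f : R -> W) t df :
  is_derive t (1 : R) f df -> derive1 f t = df.
Proof. by move=> [_ <-]; rewrite derive1E. Qed.

Lemma paravector_slice_pt I u v :
  paravector (slice_pt I u v) = u%:A + v *: paravector I.
Proof.
rewrite /slice_pt paravector_linear paravector_delta0; congr (_ + _).
exact: paravectorZ.
Qed.

Lemma paraconj_slice_pt I u v : unit_sphere I ->
  paraconj (slice_pt I u v) = u%:A - v *: paravector I.
Proof.
move=> [I0 _]; rewrite paraconjE paravector_slice_pt.
rewrite /slice_pt !mxE I0 mulr0 addr0 eqxx mulr1 mulr_natl mulr2n scalerDl.
by rewrite opprD addrA addrK.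
Qed.

Lemma unit_sphere_sqr I : unit_sphere I -> paravector I * paravector I = -1.
Proof.
move=> [I0 I1]; rewrite /paravector I0 scale0r add0r vector_part_sqr I1.
by rewrite scale1r.
Qed.

Lemma slice_ptDu I h u v :
  slice_pt I (h *: 1 + u) v = h *: delta_mx 0 0 + slice_pt I u v.
Proof. by rewrite /slice_pt scalerDl [h *: 1]mulr1 addrA. Qed.

Lemma slice_ptDv I h u v :
  slice_pt I u (h *: 1 + v) = h *: I + slice_pt I u v.
Proof. by rewrite /slice_pt scalerDl [h *: 1]mulr1 addrCA. Qed.

Lemma dbarE I (g : R -> R -> cl) u v du dv :
  is_derive u (1 : R) (g ^~ v) du -> is_derive v (1 : R) (g u) dv ->
  dbar I g u v = du + paravector I * dv.
Proof. by rewrite /dbar => /is_derive_derive1 -> /is_derive_derive1 ->. Qed.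

Lemma is_derive_paravectoru I u v :
  is_derive u (1 : R) (fun u => paravector (slice_pt I u v)) 1.
Proof.
apply: is_derive_affine => h.
by rewrite slice_ptDu paravector_linear paravector_delta0.
Qed.

Lemma is_derive_paravectorv I u v :
  is_derive v (1 : R) (fun v => paravector (slice_pt I u v)) (paravector I).
Proof. by apply: is_derive_affine => h; rewrite slice_ptDv paravector_linear. Qed.

Lemma is_derive_paraconju I u v :
  is_derive u (1 : R) (fun u => paraconj (slice_pt I u v)) 1.
Proof.
apply: is_derive_affine => h.
rewrite slice_ptDu paraconj_linear paraconjE mxE eqxx paravector_delta0 mulr1.
by rewrite mulr2n scalerDl scale1r addrK.
Qed.

Lemma is_derive_paraconjv I u v : unit_sphere I ->
  is_derive v (1 : R) (fun v => paraconj (slice_pt I u v)) (- paravector I).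
Proof.
move=> [I0 _]; apply: is_derive_affine => h.
by rewrite slice_ptDv paraconj_linear [paraconj I]paraconjE I0 mulr0 scale0r sub0r.
Qed.

Lemma commr_paravector_slice I u v :
  GRing.comm (paravector I) (paravector (slice_pt I u v)).
Proof.
rewrite paravector_slice_pt; apply: commrD.
  by rewrite /GRing.comm mulr_algl mulr_algr.
by rewrite /GRing.comm -scalerAl -scalerAr.
Qed.

Lemma commr_paraconj_slice I u v : unit_sphere I ->
  GRing.comm (paravector I) (paraconj (slice_pt I u v)).
Proof.
move=> HI; rewrite paraconj_slice_pt//; apply: commrB.
  by rewrite /GRing.comm mulr_algl mulr_algr.
by rewrite /GRing.comm -scalerAl -scalerAr.
Qed.

(** On the slice (d/du + I d/dv) xbar = 1 - I^2 = 2. As I commutes with xbar, it can be moved past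
    the power to reach g, with which it need not commute. *)
Lemma dbar_paraconj_exp I k (g : R -> R -> cl) u v : unit_sphere I ->
  derivable (g ^~ v) u 1 -> derivable (g u) v 1 ->
  dbar I (fun u v => paraconj (slice_pt I u v) ^+ k * g u v) u v =
  (2 * k%:R : R) *: (paraconj (slice_pt I u v) ^+ k.-1 * g u v)
  + paraconj (slice_pt I u v) ^+ k * dbar I g u v.
Proof.
move=> HI /derivableP du /derivableP dv.
have cI := commr_paraconj_slice u v HI.
have Du := is_derive_clifford_mul
  (is_derive_clifford_exp k (commr1 _) (is_derive_paraconju I u v)) du.
have Dv := is_derive_clifford_mul
  (is_derive_clifford_exp (f := fun v => paraconj (slice_pt I u v)) k
    (commrN (commr_sym cI)) (is_derive_paraconjv u v HI)) dv.
rewrite (dbarE I Du Dv) (dbarE I du dv).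
move: (unit_sphere_sqr HI) (commrX k cI) (commrX k.-1 cI).
set p := paraconj _; set J := paravector I => JJ ck ck1.
rewrite mulr1 !mulrDr [J * (p ^+ k * _)]mulrA ck -mulrA.
rewrite -!scalerAl -scalerAr mulrN mulNr mulrN -mulrA [J * (p ^+ k.-1 * _)]mulrA ck1.
rewrite -!mulrA [J * (J * _)]mulrA JJ mulN1r mulrN opprK.
rewrite addrACA -scalerDl; congr (_ *: _ + _).
by rewrite mulr_natl mulr2n.
Qed.

(** Here (d/du + I d/dv) x = 1 + I^2 = 0, and I commutes with x. The scalar c covers the 0/1
    coefficients of the components and the constants of [iter_dbar]. *)
Lemma dbar_paravector_exp I (c : R) j u v : unit_sphere I ->
  dbar I (fun u v => c *: paravector (slice_pt I u v) ^+ j) u v = 0.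
Proof.
move=> HI; have cI := commr_paravector_slice I u v.
have Du := is_deriveZ c
  (is_derive_clifford_exp j (commr1 _) (is_derive_paravectoru I u v)).
have Dv := is_deriveZ c
  (is_derive_clifford_exp (f := fun v => paravector (slice_pt I u v)) j
    (commr_sym cI) (is_derive_paravectorv I u v)).
rewrite (dbarE I Du Dv).
move: (unit_sphere_sqr HI) (commrX j.-1 cI).
set p := paravector (slice_pt I u v); set J := paravector I => JJ ck.
by rewrite -!scalerAr mulrA ck -mulrA JJ mulrN mulr1 !scalerN subrr.
Qed.

Lemma derivable_paravector_expu I (c : R) j u v :
  derivable (fun u => c *: paravector (slice_pt I u v) ^+ j) u 1.
Proof.
by have [] := is_deriveZ c
  (is_derive_clifford_exp j (commr1 _) (is_derive_paravectoru I u v)).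
Qed.

Lemma derivable_paravector_expv I (c : R) j u v :
  derivable (fun v => c *: paravector (slice_pt I u v) ^+ j) v 1.
Proof.
by have [] := is_deriveZ c (is_derive_clifford_exp
  (f := fun v => paravector (slice_pt I u v)) j
  (commr_sym (commr_paravector_slice I u v)) (is_derive_paravectorv I u v)).
Qed.

(** Each application brings down twice the current exponent of xbar; the falling factorial vanishes
    once N > k, which gives polyanalyticity of order m + 1 for k <= m. *)
Lemma iter_dbar I N k j : unit_sphere I ->
  iter N (dbar I)
    (fun u v => paraconj (slice_pt I u v) ^+ k * paravector (slice_pt I u v) ^+ j) =
  fun u v => paraconj (slice_pt I u v) ^+ (k - N) *
    ((2 ^+ N * (k ^_ N)%:R : R) *: paravector (slice_pt I u v) ^+ j).
Proof.
move=> HI; elim: N => [|N IH].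
  by apply/funext => u; apply/funext => v; rewrite /= subn0 mulr1 scale1r.
rewrite iterS IH; apply/funext => u; apply/funext => v.
rewrite dbar_paraconj_exp//; [|exact: derivable_paravector_expu|
  exact: derivable_paravector_expv].
rewrite dbar_paravector_exp// mulr0 addr0 -!scalerAr scalerA subnS.
by congr (_ *: _); rewrite exprS ffactnSr natrM; ring.
Qed.

Lemma dbar_sum I m (F : nat -> R -> R -> cl) u v :
  (forall k, derivable (F k ^~ v) u 1) -> (forall k, derivable (F k u) v 1) ->
  dbar I (fun u v => \sum_(k < m) F k u v) u v = \sum_(k < m) dbar I (F k) u v.
Proof.
move=> du dv.
have Du := @is_derive_sum _ _ _ m (fun k u => F k u v) u 1 _
  (fun k => derivableP (du k)).
have Dv := @is_derive_sum _ _ _ m (fun k v => F k u v) v 1 _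
  (fun k => derivableP (dv k)).
rewrite !fct_sumE in Du Dv.
rewrite (dbarE I Du Dv) mulr_sumr -big_split /=; apply: eq_bigr => k _.
by rewrite (dbarE I (derivableP (du k)) (derivableP (dv k))).
Qed.

(* Applying [dbar] lowers the degree in the conjugate variable by one. *)
Lemma polyanalytic_unique I (U : R -> R -> Prop) m (g : nat -> R -> R -> cl) :
  unit_sphere I ->
  (forall u v, U u v -> \forall u' \near u, U u' v) ->
  (forall u v, U u v -> \forall v' \near v, U u v') ->
  (forall k u v, U u v -> [/\ derivable (g k ^~ v) u 1, derivable (g k u) v 1 &
     dbar I (g k) u v = 0]) ->
  (forall u v, U u v ->
     \sum_(k < m) paraconj (slice_pt I u v) ^+ k * g k u v = 0) ->
  forall k u v, (k < m)%N -> U u v -> g k u v = 0.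
Proof.
move=> HI Uu Uv; elim: m g => [//|m IH] g gU gs.
(* Applying [dbar] to the relation yields one with m terms for the functions 2 (k + 1) g_(k+1), to
   which the induction hypothesis applies. *)
have gS k u v : (k < m)%N -> U u v -> g k.+1 u v = 0.
  move=> km Huv.
  suff : (2 * k.+1%:R : R) *: g k.+1 u v = 0.
    by move/eqP; rewrite scaler_eq0 mulf_eq0 !pnatr_eq0 /= => /eqP.
  apply: (IH (fun k u v => (2 * k.+1%:R : R) *: g k.+1 u v) _ _ k u v km Huv).
    move=> l u' v' H; have [du dv db] := gU l.+1 u' v' H.
    split; [exact: derivableZ|exact: derivableZ|].
    move/derivableP : du => du; move/derivableP : dv => dv.
    rewrite (dbarE I (g := fun u v => (2 * l.+1%:R : R) *: g l.+1 u v)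
      (is_deriveZ _ du) (is_deriveZ _ dv)).
    by rewrite -scalerAr -scalerDr -(dbarE I du dv) db scaler0.
  move=> u' v' H.
  pose F k u v : cl := paraconj (slice_pt I u v) ^+ k * g k u v.
  have dFu l : derivable (F l ^~ v') u' 1.
    have [/derivableP du _ _] := gU l u' v' H.
    by have [] := is_derive_clifford_mul
      (is_derive_clifford_exp l (commr1 _) (is_derive_paraconju I u' v')) du.
  have dFv l : derivable (F l u') v' 1.
    have [_ /derivableP dv _] := gU l u' v' H.
    by have [] := is_derive_clifford_mul
      (is_derive_clifford_exp (f := fun v => paraconj (slice_pt I u' v)) l
        (commrN (commr_sym (commr_paraconj_slice u' v' HI)))
        (is_derive_paraconjv u' v' HI)) dv.
  (* The sum vanishes throughout a neighbourhood in each variable, so its partial derivatives vanish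
     too. *)
  have Zu : is_derive u' (1 : R) (fun u => \sum_(k < m.+1) F k u v') 0.
    apply: (near_eq_is_derive _ (is_derive_cst 0 _ _)).
    by apply: filterS (Uu _ _ H) => w Hw; rewrite gs.
  have Zv : is_derive v' (1 : R) (fun v => \sum_(k < m.+1) F k u' v) 0.
    apply: (near_eq_is_derive _ (is_derive_cst 0 _ _)).
    by apply: filterS (Uv _ _ H) => w Hw; rewrite gs.
  have := dbar_sum I m.+1 dFu dFv.
  rewrite (dbarE I (g := fun u v => \sum_(k < m.+1) F k u v) Zu Zv).
  rewrite mulr0 addr0 big_ord_recl => /esym F0; rewrite -[RHS]F0.
  have dF l : dbar I (F l) u' v' =
      (2 * l%:R : R) *: (paraconj (slice_pt I u' v') ^+ l.-1 * g l u' v').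
    have [du dv db] := gU l u' v' H.
    by rewrite /F (dbar_paraconj_exp l HI du dv) db mulr0 addr0.
  rewrite dF mulr0 scale0r add0r; apply: eq_bigr => l _.
  by rewrite dF -scalerAr.
case=> [|k] u v km Huv; last exact: gS.
have := gs u v Huv; rewrite big_ord_recl big1 ?addr0 ?expr0 ?mul1r//.
by move=> i _; rewrite gS ?mulr0.
Qed.

End SliceCalculus.

(** * Smoothness of polynomials, locality of the Laplacian, slices through points *)

Section PolynomialFunctions.
Variables (R : realType) (n : nat).
Notation pt := 'rV[R]_n.+1.
Notation cl := (clifford R n).
Implicit Types (I x : pt) (Om : set pt).

(** A class closed under partial derivatives, so that C^k follows by induction on k without formulas
    for higher derivatives. Clifford constants are included because x and xbar have the derivatives
    e_i and conj(e_i). *)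
Inductive paravector_poly : (pt -> cl) -> Prop :=
| poly_cst c : paravector_poly (fun=> c)
| poly_paravector : paravector_poly (@paravector R n)
| poly_paraconj : paravector_poly (@paraconj R n)
| poly_add f g : paravector_poly f -> paravector_poly g ->
    paravector_poly (fun x => f x + g x)
| poly_mul f g : paravector_poly f -> paravector_poly g ->
    paravector_poly (fun x => f x * g x).

Lemma poly_exp f k : paravector_poly f -> paravector_poly (fun x => f x ^+ k).
Proof.
move=> pf; elim: k => [|k IH]; first exact: poly_cst.
rewrite (_ : (fun x => _) = fun x => f x * f x ^+ k); first exact: poly_mul.
by apply/funext => x; rewrite exprS.
Qed.

Lemma differentiable_paravector x : differentiable (@paravector R n) x.
Proof.
have dZ i (w : cl) : differentiable (fun y : pt => y 0 i *: w) x.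
  by apply: differentiableZl; exact: differentiable_coord.
apply: differentiableD; first exact: dZ.
rewrite (_ : @vector_part R n =
    \sum_(l < n) (fun y : pt => y 0 (lift ord0 l) *: clifford_gen R l)).
  by apply: differentiable_sum => l; exact: dZ.
by apply/funext => y; rewrite fct_sumE.
Qed.

Lemma differentiable_paraconj x : differentiable (@paraconj R n) x.
Proof.
rewrite (_ : @paraconj R n = fun y => (2 * y 0 0) *: (1 : cl) - paravector y).
  apply: differentiableB; last exact: differentiable_paravector.
  apply: differentiableZl; apply: differentiableM => //.
  exact: differentiable_coord.
by apply/funext => y; rewrite paraconjE.
Qed.

Lemma poly_differentiable f x : paravector_poly f -> differentiable f x.
Proof.
elim=> [c|||g h _ dg _ dh|g h _ dg _ dh].
- exact: differentiable_cst.
- exact: differentiable_paravector.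
- exact: differentiable_paraconj.
- exact: differentiableD.
- exact: differentiable_clifford_mul.
Qed.

Lemma poly_derive f i : paravector_poly f ->
  exists2 g, paravector_poly g & forall x, is_derive x (delta_mx 0 i) f (g x).
Proof.
elim=> [c|||g h pg [g' pg' dg] ph [h' ph' dh]|g h pg [g' pg' dg] ph [h' ph' dh]].
- by exists (fun=> 0) => [|x]; [exact: poly_cst|exact: is_derive_cst].
- exists (fun=> paravector (delta_mx 0 i)) => [|x]; first exact: poly_cst.
  by apply: is_derive_affine => t; exact: paravector_linear.
- exists (fun=> paraconj (delta_mx 0 i)) => [|x]; first exact: poly_cst.
  by apply: is_derive_affine => t; exact: paraconj_linear.
- exists (fun x => g' x + h' x) => [|x]; first exact: poly_add.
  exact: is_deriveD.
- exists (fun x => g' x * h x + g x * h' x) => [|x].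
    by apply: poly_add; exact: poly_mul.
  exact: is_derive_clifford_mul.
Qed.

Lemma poly_Ck k Om f : paravector_poly f -> Ck k Om f.
Proof.
elim: k f => [|k IH] f pf; split => //.
- by move=> x _; apply: differentiable_continuous; exact: poly_differentiable.
- by move=> x _; apply: differentiable_continuous; exact: poly_differentiable.
move=> i; have [g pg dg] := poly_derive i pf.
split=> [x _|]; first by have [] := dg x.
rewrite (_ : partial i f = g); first exact: IH.
by apply/funext => x; have [_ <-] := dg x.
Qed.

(** Functions equal on an open set are equal near each of its points, hence have equal derivatives
    there. The chosen components are known only on [Om]. *)
Lemma eq_laplacian Om f g : open Om -> (forall x, Om x -> f x = g x) ->
  forall x, Om x -> laplacian f x = laplacian g x.
Proof.
move=> oOm fg.
have eq_partial i (f1 g1 : pt -> cl) : (forall x, Om x -> f1 x = g1 x) ->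
    forall x, Om x -> partial i f1 x = partial i g1 x.
  move=> fg1 x Omx; apply: near_eq_derive.
  by apply: filterS (open_nbhs_nbhs (conj oOm Omx)) => y /fg1.
move=> x Omx; apply: eq_bigr => i _; exact: (eq_partial _ _ _ (eq_partial _ _ _ fg)).
Qed.

Lemma eq_iter_laplacian Om f g r : open Om -> (forall x, Om x -> f x = g x) ->
  forall x, Om x -> iter r (@laplacian R n) f x = iter r (@laplacian R n) g x.
Proof.
move=> oOm fg; elim: r => [|r IH] x Omx; first exact: fg.
exact: (eq_laplacian oOm IH Omx).
Qed.

Lemma iter_laplacian0 r : iter r (@laplacian R n) (fun=> 0) = fun=> 0.
Proof.
have p0 i : partial i (fun=> 0 : cl) = fun=> 0.
  by apply/funext => x; exact: derive_cst.
elim: r => [//|r IH]; rewrite iterS IH; apply/funext => x.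
by rewrite /laplacian big1// => i _; rewrite !p0.
Qed.

Lemma slice_ptP x : (0 < n)%N ->
  exists I u v, unit_sphere I /\ x = slice_pt I u v.
Proof.
move=> n0.
pose s := \sum_(l < n) x 0 (lift ord0 l) ^+ 2.
have s0 : 0 <= s by apply: sumr_ge0 => l _; exact: sqr_ge0.
have [sE|sn0] := eqVneq s 0.
  (* On the real axis any imaginary unit will do; off it, I is the normalized vector part of x. *)
  pose I : pt := delta_mx 0 (lift ord0 (Ordinal n0)).
  exists I, (x 0 0), 0; split; first split.
  - by rewrite mxE.
  - rewrite (bigD1 (Ordinal n0)) //= big1 ?addr0.
      by rewrite mxE !eqxx expr1n.
    move=> l l0; rewrite mxE (inj_eq lift_inj) eqxx (negPf l0) /=.
    by rewrite expr0n.
  apply/rowP => i; rewrite !mxE mul0r addr0.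
  have [->|i0] := eqVneq i 0; first by rewrite mulr1.
  have [l ->] : exists l, i = lift ord0 l.
    by case: (unliftP ord0 i) => [l|] E; [exists l|rewrite E eqxx in i0].
  move/eqP : sE; rewrite psumr_eq0; last by move=> ? _; exact: sqr_ge0.
  by move=> /allP/(_ l (mem_index_enum _)); rewrite sqrf_eq0 mulr0 => /eqP.
pose v := Num.sqrt s.
have v0 : v != 0 by rewrite sqrtr_eq0 -ltNge lt0r sn0.
exists (v^-1 *: (x - x 0 0 *: delta_mx 0 0)), (x 0 0), v; split; first split.
- by rewrite !mxE mulr1 subrr mulr0.
- under eq_bigr do rewrite !mxE mulr0 subr0 exprMn.
  by rewrite -mulr_sumr -/s exprVn sqr_sqrtr// mulVf.
by rewrite /slice_pt scalerA mulfV// scale1r addrC subrK.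
Qed.

Lemma near_slice_ptu Om I u v : open Om -> Om (slice_pt I u v) ->
  \forall u' \near u, Om (slice_pt I u' v).
Proof.
move=> oOm Hx.
have c : {for u, continuous (fun u' => slice_pt I u' v)}.
  apply: cvgD; last exact: cvg_cst.
  by apply: cvgZr_tmp; exact: cvg_id.
exact: (c _ (open_nbhs_nbhs (conj oOm Hx))).
Qed.

Lemma near_slice_ptv Om I u v : open Om -> Om (slice_pt I u v) ->
  \forall v' \near v, Om (slice_pt I u v').
Proof.
move=> oOm Hx.
have c : {for v, continuous (fun v' => slice_pt I u v')}.
  apply: cvgD; first exact: cvg_cst.
  by apply: cvgZr_tmp; exact: cvg_id.
exact: (c _ (open_nbhs_nbhs (conj oOm Hx))).
Qed.

End PolynomialFunctions.

(** * Monomials as slice polyanalytic functions, and their components *)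

Section PolyanalyticMonomials.
Variables (R : realType) (n : nat).
Notation pt := 'rV[R]_n.+1.
Notation cl := (clifford R n).
Implicit Types (I x : pt) (Om : set pt).

(* The real and imaginary parts of [(u + i v)^j]. *)
Fixpoint cpow (u v : R) (j : nat) : R * R :=
  if j is j'.+1 then
    let: (a, b) := cpow u v j' in (u * a - v * b, u * b + v * a)
  else (1, 0).

Lemma cpowN u v j : cpow u (- v) j = ((cpow u v j).1, - (cpow u v j).2).
Proof.
elim: j => [|j IH] /=; first by rewrite oppr0.
by rewrite IH; case: (cpow u v j) => a b /=; congr (_, _); ring.
Qed.

Lemma complex_mul (A : algType R) (J : A) (a b c d : R) : J * J = -1 ->
  (a%:A + b *: J) * (c%:A + d *: J) =
  (a * c - b * d)%:A + (a * d + b * c) *: J.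
Proof.
move=> JJ; rewrite mulrDl !mulrDr !mulr_algl !mulr_algr -scalerAl -scalerAr JJ.
rewrite !scalerA !scalerN scalerBl scalerDl [RHS]addrACA.
by rewrite [X in _ = _ + X]addrC [c * b]mulrC.
Qed.

(** R + R J is a copy of the complex numbers, with coordinates that do not depend on J; this is what
    makes the monomials slice functions. *)
Lemma cpowE (A : algType R) (J : A) u v j : J * J = -1 ->
  (u%:A + v *: J) ^+ j = (cpow u v j).1%:A + (cpow u v j).2 *: J.
Proof.
move=> JJ; elim: j => [|j IH] /=; first by rewrite expr0 scale1r scale0r addr0.
by rewrite exprS IH complex_mul//; case: (cpow u v j).
Qed.

(** With z = u + i v, alpha and beta are the real and imaginary parts of conj(z)^k z^j; the parities
    in v express conjugation. *)
Lemma slice_function_monomial Om k j :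
  slice_function Om (fun x : pt => paraconj x ^+ k * paravector x ^+ j : cl).
Proof.
exists (fun u v => ((cpow u v k).1 * (cpow u v j).1
                    + (cpow u v k).2 * (cpow u v j).2)%:A).
exists (fun u v => ((cpow u v k).1 * (cpow u v j).2
                    - (cpow u v k).2 * (cpow u v j).1)%:A).
split=> [u v|u v|I u v HI _].
- by rewrite !cpowN /=; congr (_%:A); ring.
- by rewrite !cpowN /= -[RHS]scaleNr; congr (_ *: _); ring.
rewrite paravector_slice_pt paraconj_slice_pt// -scaleNr !cpowE ?unit_sphere_sqr//.
rewrite cpowN /=; move: (cpow u v k) (cpow u v j) => [a b] [c d] /=.
rewrite complex_mul ?unit_sphere_sqr// mulr_algr.
by congr (_%:A + _ *: _); ring.
Qed.

Lemma polyanalytic_components_monomial m Om k j (l : 'I_m.+1) x :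
  (0 < n)%N -> open Om -> (k <= m)%N -> Om x ->
  polyanalytic_components Om
    (fun x : pt => paraconj x ^+ k * paravector x ^+ j) l x =
  ((l == k :> nat)%:R : R) *: paravector x ^+ j.
Proof.
move=> n0 oOm km Omx; set f := fun x => _.
have : polyanalytic_decomposition Om f (polyanalytic_components (m := m) Om f).
  (* An explicit decomposition ensures that [xget] returns a decomposition and not its default
     value. *)
  suff dec : [set g | polyanalytic_decomposition Om f g]
      (fun (l : 'I_m.+1) x => ((l == k :> nat)%:R : R) *: paravector x ^+ j).
    exact: (xgetI _ dec).
  split=> [i|y _].
    split=> [y _|I u v HI _]; last exact: dbar_paravector_exp.
    apply: differentiableZ; apply: differentiable_clifford_exp.
    exact: differentiable_paravector.
  rewrite (bigD1 (inord k)) //= inordK// eqxx scale1r big1 ?addr0// => i ik.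
  case: eqP => [e|_]; last by rewrite scale0r mulr0.
  by case/eqP: ik; apply: val_inj; rewrite /= inordK// e.
move: (polyanalytic_components (m := m) Om f) => g [gm gE].
have [I [u [v [HI xE]]]] := slice_ptP x n0.
(* The difference between the chosen and the explicit components, on the slice through x. For i > m,
   [inord i] still names one of the components, so h i is annihilated by [dbar] for every i. *)
pose h (i : nat) u v : cl := g (inord i) (slice_pt I u v)
  - ((i == k)%:R : R) *: paravector (slice_pt I u v) ^+ j.
suff : h l u v = 0.
  by move/eqP; rewrite subr_eq0 inord_val -xE => /eqP.
apply: (@polyanalytic_unique _ _ I (fun u v => Om (slice_pt I u v)) m.+1) => //.
- by move=> u' v'; exact: near_slice_ptu.
- by move=> u' v'; exact: near_slice_ptv.
- move=> i u' v' Huv; have [dg gd] := gm (inord i).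
  have d w : derivable (g (inord i)) (slice_pt I u' v') w.
    by apply: diff_derivable; exact: dg.
  have du := is_derive_line (phi := fun u => slice_pt I u v')
    (fun t => slice_ptDu I t u' v') (d _).
  have dv := is_derive_line (phi := fun v => slice_pt I u' v)
    (fun t => slice_ptDv I t u' v') (d _).
  have du' := derivableP (@derivable_paravector_expu R n I ((i == k)%:R : R) j u' v').
  have dv' := derivableP (@derivable_paravector_expv R n I ((i == k)%:R : R) j u' v').
  have Du := is_deriveB du du'; have Dv := is_deriveB dv dv'.
  split; [by have [] := Du|by have [] := Dv|].
  rewrite (dbarE I (g := h i) Du Dv).
  have := gd I u' v' HI Huv; rewrite (dbarE I (g := restr_slice _ I) du dv) => E1.
  have := dbar_paravector_exp ((i == k)%:R : R) j u' v' HI.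
  rewrite (dbarE I (g := fun u v => (i == k)%:R *: paravector (slice_pt I u v) ^+ j)
    du' dv') => E2.
  by rewrite mulrBr addrACA -opprD E1 E2 subrr.
- move=> u' v' Huv; have := gE _ Huv.
  rewrite /h; under [in X in _ -> X]eq_bigr do rewrite mulrBr inord_val.
  rewrite sumrB => <-; rewrite /f (bigD1 (inord k)) //= inordK// eqxx scale1r.
  rewrite big1 ?addr0 ?subrr// => i ik.
  case: eqP => [e|_]; last by rewrite scale0r mulr0.
  by case/eqP: ik; apply: val_inj; rewrite /= inordK// e.
- by rewrite -xE.
Qed.

Lemma fueter_sce_monomial m Om k j x :
  (0 < n)%N -> open Om -> (k <= m)%N -> Om x ->
  polyanalytic_fueter_sce m Om
    (fun x : pt => paraconj x ^+ k * paravector x ^+ j) x =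
  x 0 0 ^+ k *: iter (n.-1)./2 (@laplacian R n) (fun x => paravector x ^+ j) x.
Proof.
move=> n0 oOm km Omx.
rewrite /polyanalytic_fueter_sce (bigD1 (inord k)) //= inordK// big1 ?addr0.
  congr (_ *: _); apply: (eq_iter_laplacian _ oOm) => // y Omy.
  by rewrite polyanalytic_components_monomial// inordK// eqxx scale1r.
move=> i ik.
rewrite (eq_iter_laplacian (g := fun=> 0) _ oOm) ?iter_laplacian0 ?scaler0//.
move=> y Omy; rewrite polyanalytic_components_monomial//.
case: eqP => [e|_]; last by rewrite scale0r.
by case/eqP: ik; apply: val_inj; rewrite /= inordK// e.
Qed.

Lemma slice_polyanalytic_monomial m Om k j : (k <= m)%N ->
  slice_polyanalytic m.+1 Om
    (fun x : pt => paraconj x ^+ k * paravector x ^+ j).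
Proof.
move=> km; split; [|exact: slice_function_monomial|].
  apply: poly_Ck; apply: poly_mul; apply: poly_exp.
    exact: poly_paraconj.
  exact: poly_paravector.
move=> I u v HI _; rewrite /restr_slice iter_dbar//.
by rewrite ffact_small// mulr0 scale0r mulr0.
Qed.

Lemma clifford_appell0 x : (0 < n)%N -> clifford_appell 0 x = 1.
Proof.
move=> n0; rewrite /clifford_appell big_ord1 /appell_coef /pochhammer !big_ord0.
by rewrite bin0 !mulr1 divr1 scale1r.
Qed.

End PolyanalyticMonomials.

Theorem theorem7p9 (R : realType) (n m : nat) (hn : odd n)
    (Om : set 'rV[R]_n.+1)
    (hsym : axially_symmetric Om) (hdom : slice_domain Om)
    (k j : nat) (hk : (k <= m)%N) :
  let f : 'rV[R]_n.+1 -> clifford R n :=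
    fun x => paraconj x ^+ k * paravector x ^+ j in
  slice_polyanalytic m.+1 Om f /\
  forall x, Om x ->
    [/\ (j < n.-1)%N ->
          polyanalytic_fueter_sce m Om f x = 0,
        j = n.-1 ->
          polyanalytic_fueter_sce m Om f x =
            (x 0 0 ^+ k * 4 ^+ (n.-1)./2 * (-1) ^+ (n.-1)./2
               * Gamma ((n%:R + 1) / 2 : R) ^+ 2)%:A &
        (n.-1 <= j)%N ->
          polyanalytic_fueter_sce m Om f x =
            (Gamma ((n%:R + 1) / 2 : R) ^+ 2 * 2 ^+ n.-1 * (-1) ^+ (n.-1)./2
               * (pochhammer n%:R (j + 1 - n) / ((j + 1 - n)`!)%:R)
               * x 0 0 ^+ k) *: clifford_appell (j + 1 - n) x].
Proof.
move=> f; split=> [|x Omx]; first exact: slice_polyanalytic_monomial.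
have n0 : (0 < n)%N by exact: odd_gt0.
have [oOm _ _ _] := hdom.
pose N := (n.-1)./2.
(* Oddness of n enters here; then (n + 1)/2 = N + 1 is an integer and Gamma takes the value N!. *)
have nE : n = N.*2.+1 by rewrite /N; lia.
have GammaE : Gamma ((n%:R + 1) / 2 : R) = N`!%:R.
  rewrite -Gamma_nat; congr Gamma; rewrite nE -natr1 -muln2 natrM.
  by field.
have pow4 : 2 ^+ n.-1 = 4 ^+ N :> R.
  by rewrite [in LHS]nE /= -mul2n exprM; congr (_ ^+ _); ring.
have C_lt : (j < n.-1)%N -> polyanalytic_fueter_sce m Om f x = 0.
  move=> jn; rewrite fueter_sce_monomial// iter_laplacian_paravector.
  have -> : (((n.-1)./2).*2 <= j)%N = false by apply/negbTE; lia.
  by rewrite scale0r scaler0.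
have C_ge : (n.-1 <= j)%N -> polyanalytic_fueter_sce m Om f x =
    (Gamma ((n%:R + 1) / 2 : R) ^+ 2 * 2 ^+ n.-1 * (-1) ^+ (n.-1)./2
     * (pochhammer n%:R (j + 1 - n) / ((j + 1 - n)`!)%:R)
     * x 0 0 ^+ k) *: clifford_appell (j + 1 - n) x.
  move=> nj; rewrite fueter_sce_monomial// iter_laplacian_paravector.
  have -> : (((n.-1)./2).*2 <= j)%N by lia.
  have -> : (j - ((n.-1)./2).*2 = j + 1 - n)%N by lia.
  rewrite prod_fueter_coef// (fueter_series_appell _ _ nE) !scalerA GammaE pow4 -/N.
  by congr (_ *: _); ring.
(* The case j = n - 1 is the general formula in degree 0, where the Appell polynomial and the
   Pochhammer quotient are both 1. *)
split=> // jn; rewrite C_ge ?jn//.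
have -> : (n.-1 + 1 - n = 0)%N by lia.
rewrite clifford_appell0// GammaE pow4 -/N; congr (_ *: _).
by rewrite /pochhammer big_ord0 divr1; ring.
Qed.
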